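(* Let $p$ be a prime and let $\mathcal{G}=(G,\theta)$ be a finitely generated torsion free cyclotomic pro-$p$ pair. Then $\mathcal{G}$ is Kummerian if and only if, for every positive integer $n$, the map \[H^1(G,\mathbb{Z}/p^n(1)_\theta)\to H^1(G,\mathbb{Z}/p(1)_\theta)\] induced by the canonical projection $\mathbb{Z}/p^n\to\mathbb{Z}/p$ is surjective.
   Context: A cyclotomic pro-$p$ pair is a pair $(G,\theta)$ with $G$ a pro-$p$ group and $\theta\colon G\to 1+p\mathbb{Z}_p$ a continuous homomorphism; it is finitely generated if $G$ is finitely generated as a pro-$p$ group, and torsion free if $\mathrm{Im}(\theta)$ is torsion free. $K(\mathcal{G})$ is the closed subgroup of $G$ generated by all $h^{-\theta(g)}ghg^{-1}$ with $g\in G$, $h\in\mathrm{Ker}(\theta)$; the pair is Kummerian if $\mathrm{Ker}(\theta)/K(\mathcal{G})$ is a free abelian pro-$p$ group. $\mathbb{Z}/p^n(1)_\theta$ denotes the $G$-module with underlying group $\mathbb{Z}/p^n$ and action $g\cdot\alpha=\theta(g)\alpha$ (so $\mathbb{Z}/p(1)_\theta$ is the trivial module $\mathbb{Z}/p$); $H^1$ is continuous cohomology. *)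

(* Defs.v *)
From HB Require Import structures.
From mathcomp Require Import all_boot all_order all_algebra.
From mathcomp Require Import ring_quotient.
From mathcomp Require Import all_classical topology.

Set Implicit Arguments.
Unset Strict Implicit.
Unset Printing Implicit Defensive.

Import GRing.Theory.
Local Open Scope classical_set_scope.
Local Open Scope ring_scope.

HB.mixin Record isTopologicalGroup G of Group G & Topological G := {
  mulg_continuous : continuous (fun xy : G * G => (xy.1 * xy.2)%g);
  invg_continuous : continuous (fun x : G => (x^-1)%g)
}.

#[short(type="topGroupType")]
HB.structure Definition TopGroup :=
  {G of Group G & Topological G & isTopologicalGroup G}.

Definition is_subgroup (G : groupType) (H : set G) : Prop :=
  H 1%g /\ forall x y, H x -> H y -> H (x / y)%g.

Record subgroup (G : groupType) := Subgroup {
  subgroup_set :> set G;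
  subgroupP : is_subgroup subgroup_set }.

Record normalSubgroup (G : groupType) := NormalSubgroup {
  normal_subgroup :> subgroup G;
  normalP : forall x y : G,
    subgroup_set normal_subgroup x -> subgroup_set normal_subgroup (x ^ y)%g }.

Section SubgroupTheory.
Variables (G : groupType) (H : subgroup G).
Local Notation sH := (subgroup_set H).
Local Open Scope group_scope.

Lemma subgroup1 : sH 1. Proof. by case: (subgroupP H). Qed.

Lemma subgroupV x : sH x -> sH x^-1.
Proof.
move=> Hx; rewrite -[x^-1]mul1g.
by apply: (subgroupP H).2 => //; exact: subgroup1.
Qed.

Lemma subgroupM x y : sH x -> sH y -> sH (x * y).
Proof.
by move=> Hx Hy; rewrite -[y]invgK; apply/(subgroupP H).2 => //; exact: subgroupV.
Qed.

Lemma subgroup_group_closed : group_closed (mem (H : set G)).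
Proof.
split; first by apply/mem_set/subgroup1.
by move=> x y /set_mem Hx /set_mem Hy; apply/mem_set/(subgroupP H).2.
Qed.
End SubgroupTheory.

Definition subgroup_type (G : groupType) (H : subgroup G) : Type :=
  set_type (subgroup_set H).

Section SubgroupGroup.
Variables (G : groupType) (H : subgroup G).

HB.instance Definition _ := SubChoice.on (subgroup_type H).
HB.instance Definition _ :=
  SubChoice_isSubGroup.Build G _ (subgroup_type H) (subgroup_group_closed H).
End SubgroupGroup.

Section SubgroupTop.
Variables (G : topGroupType) (H : subgroup G).
Local Notation S := (subgroup_type H).
Local Open Scope group_scope.

HB.instance Definition _ := Topological.on S.

Let val_continuous : continuous (val : S -> G).
Proof. exact: initial_continuous. Qed.

Let subgroup_continuousP (T : topologicalType) (f : T -> S) :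
  continuous (val \o f) -> continuous f.
Proof.
move=> /continuousP cf; apply/continuousP => A [B oB <-].
by rewrite -comp_preimage; exact: cf.
Qed.

Let mul_continuous : continuous (fun xy : S * S => (xy.1 * xy.2)).
Proof.
apply: subgroup_continuousP => -[x y] U.
move=> /(@mulg_continuous G (val x, val y)) [[A B] /= [nA nB] sAB].
exists (val @^-1` A, val @^-1` B) => /=.
  by split; exact: val_continuous.
by move=> [u v] /= [Au Bv]; exact: (sAB (val u, val v)).
Qed.

Let inv_continuous : continuous (fun x : S => x^-1).
Proof.
apply: subgroup_continuousP => x.
rewrite (_ : _ \o _ = (fun x : G => x^-1) \o (val : S -> G)); last first.
  exact/funext.
by apply: continuous_comp; [exact: val_continuous | exact: invg_continuous].
Qed.

HB.instance Definition _ :=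
  isTopologicalGroup.Build S mul_continuous inv_continuous.
End SubgroupTop.

Section QuotientGroup.
Variables (G : groupType) (N : normalSubgroup G).
Local Open Scope group_scope.
Local Open Scope quotient_scope.

Definition coset_equiv (x y : G) : bool := `[< subgroup_set N (x^-1 * y) >].

Let coset_equiv_is_equiv : equiv_class_of coset_equiv.
Proof.
split=> [x|x y|y x z].
- by apply/asboolP; rewrite mulVg; exact: subgroup1.
- by apply/asboolP/asboolP => /subgroupV; rewrite invgM invgK.
- move=> /asboolP xy /asboolP yz; apply/asboolP.
  by rewrite -(mulgK y x^-1) -mulgA; exact: subgroupM.
Qed.

Canonical coset_equiv_equiv := EquivRelPack coset_equiv_is_equiv.
Canonical coset_equiv_encModRel := defaultEncModRel coset_equiv.

Definition quotient_group : Type := {eq_quot coset_equiv}.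
HB.instance Definition _ := Choice.on quotient_group.
HB.instance Definition _ : EqQuotient G coset_equiv quotient_group :=
  EqQuotient.on quotient_group.

Local Notation Q := quotient_group.

Definition coset_proj (x : G) : Q := \pi_Q x.
Local Notation pi := coset_proj.

Lemma eq_cosetP (x y : G) : pi x = pi y <-> subgroup_set N (x^-1 * y).
Proof.
split; first by move=> /eqP; rewrite /coset_proj piE => /asboolP.
by move=> Nxy; apply/eqP; rewrite /coset_proj piE; apply/asboolP.
Qed.

Definition coset_one : Q := pi 1.
Definition coset_mul (x y : Q) : Q := pi (repr x * repr y).
Definition coset_inv (x : Q) : Q := pi (repr x)^-1.
Local Notation qone := coset_one.
Local Notation qmul := coset_mul.
Local Notation qinv := coset_inv.

Let projK (x : Q) : pi (repr x) = x.
Proof. exact: reprK. Qed.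

Let reprP (x : G) : subgroup_set N ((repr (pi x))^-1 * x).
Proof. by apply/eq_cosetP; rewrite projK. Qed.

Let qmulE (x y : G) : qmul (pi x) (pi y) = pi (x * y).
Proof.
apply/eq_cosetP; set x' := repr _; set y' := repr _.
have -> : (x' * y')^-1 * (x * y) = ((x'^-1 * x) ^ y') * (y'^-1 * y).
  by rewrite /conjg invgM !mulgA mulgK.
by apply: subgroupM; [apply: normalP|]; exact: reprP.
Qed.

Let qinvE (x : G) : qinv (pi x) = pi x^-1.
Proof.
apply/eq_cosetP; set x' := repr _; rewrite invgK.
have -> : x' * x^-1 = (x'^-1 * x)^-1 ^ x'^-1.
  by rewrite /conjg invgM !invgK !mulgA mulgK.
by apply/normalP/subgroupV/reprP.
Qed.

Let qmulA : associative qmul.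
Proof.
move=> x y z; rewrite -[x]projK -[y]projK -[z]projK.
by rewrite (qmulE (repr y)) (qmulE (repr x) (repr y)) !qmulE mulgA.
Qed.

Let qmul1 : left_id qone qmul.
Proof. by move=> x; rewrite -[x]projK qmulE mul1g. Qed.

Let qmulr1 : right_id qone qmul.
Proof. by move=> x; rewrite -[x]projK qmulE mulg1. Qed.

Let qmulV : left_inverse qone qinv qmul.
Proof. by move=> x; rewrite -[x]projK qinvE qmulE mulVg. Qed.

Let qmulrV : right_inverse qone qinv qmul.
Proof. by move=> x; rewrite -[x]projK qinvE qmulE mulgV. Qed.

HB.instance Definition _ :=
  isGroup.Build Q qmulA qmul1 qmulr1 qmulV qmulrV.

Lemma quotient_group_mulE (x y : G) : pi (x * y) = pi x * pi y.
Proof. exact/esym/qmulE. Qed.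

Lemma quotient_group_invE (x : G) : pi x^-1 = (pi x)^-1.
Proof. exact/esym/qinvE. Qed.
End QuotientGroup.

Section QuotientTop.
Variables (G : topGroupType) (N : normalSubgroup G).
Local Notation Q := (quotient_group N).
Local Open Scope group_scope.
Local Open Scope quotient_scope.

Local Notation pi := (@coset_proj G N).

Let projK (x : Q) : pi (repr x) = x.
Proof. exact: reprK. Qed.

Definition quotient_group_open : set_system Q :=
  [set U | open (pi @^-1` U)].

Let quotient_openT : quotient_group_open setT.
Proof. by rewrite /quotient_group_open /= preimage_setT; exact: openT. Qed.

Let quotient_openI : setI_closed quotient_group_open.
Proof. by move=> A B oA oB; exact: openI. Qed.

Let quotient_open_bigU (I : Type) (f : I -> set Q) :
  (forall i, quotient_group_open (f i)) ->
  quotient_group_open (\bigcup_i f i).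
Proof. by move=> of_; apply: bigcup_open => i _; exact: of_. Qed.

HB.instance Definition _ :=
  isOpenTopological.Build Q quotient_openT quotient_openI quotient_open_bigU.

Lemma coset_proj_continuous : continuous (pi : G -> Q).
Proof. exact/continuousP. Qed.

Lemma coset_proj_open (U : set G) : open U -> open (pi @` U).
Proof.
move=> oU; change (open (pi @^-1` (pi @` U))).
have -> : pi @^-1` (pi @` U) =
    \bigcup_(n in (N : set G)) [set x | U (x * n)].
  apply/seteqP; split => x /=.
    move=> [u Uu /esym/eq_cosetP Nxu]; exists (x^-1 * u) => //=.
    by rewrite mulVKg.
  move=> [n Nn /= Uxn]; exists (x * n) => //.
  by apply/esym/eq_cosetP; rewrite mulKg.
apply: bigcup_open => n _.
have : continuous (fun x : G => x * n).
  move=> x; apply: (continuous_comp (f := fun x => (x, n))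
    (g := fun xy : G * G => xy.1 * xy.2)); last exact: mulg_continuous.
  by apply: cvg_pair; [exact: cvg_id | exact: cvg_cst].
by move=> /continuousP; exact.
Qed.

Let mul_continuous : continuous (fun xy : Q * Q => xy.1 * xy.2).
Proof.
move=> -[x y]; rewrite -[x]projK -[y]projK /=.
move: (repr x) (repr y) => {}x {}y U.
rewrite /= -quotient_group_mulE => /coset_proj_continuous.
move=> /(@mulg_continuous G (x, y)).
move=> [[A B] /= [nA nB] sAB].
have pinbhs (z : G) C : nbhs z C -> nbhs (pi z) (pi @` C).
  rewrite !nbhsE => -[D [oD Dz] DC]; exists (pi @` D).
    by split; [exact: coset_proj_open | exists z].
  exact: image_subset.
exists (pi @` A, pi @` B) => /=.
  by split; exact: pinbhs.
move=> [_ _] /= [[a Aa <-] [b Bb <-]]; rewrite -quotient_group_mulE.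
exact: (sAB (a, b)).
Qed.

Let inv_continuous : continuous (fun x : Q => x^-1).
Proof.
apply/continuousP => A oA; change (open ((fun x => (pi x)^-1) @^-1` A)).
move: A oA; apply/continuousP.
rewrite (_ : (fun x => _) = pi \o (fun x : G => x^-1)); last first.
  by apply/funext => x /=; rewrite quotient_group_invE.
by move=> x; apply: continuous_comp; [exact: invg_continuous|exact: coset_proj_continuous].
Qed.

HB.instance Definition _ :=
  isTopologicalGroup.Build Q mul_continuous inv_continuous.
End QuotientTop.

Definition closed_gen_set (G : topGroupType) (S : set G) : set G :=
  smallest (fun H => is_subgroup H /\ closed H) S.

Lemma closed_gen_subgroup (G : topGroupType) (S : set G) :
  is_subgroup (closed_gen_set S).
Proof.
split; first by move=> H [[]] [].
by move=> x y Sx Sy H [[sH cH] SH]; apply: sH.2; [exact: Sx | exact: Sy].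
Qed.

Definition closed_gen (G : topGroupType) (S : set G) : subgroup G :=
  Subgroup (closed_gen_subgroup S).

Definition topologically_fg (G : topGroupType) : Prop :=
  exists2 S : set G, finite_set S & closed_gen S = setT :> set G.

Definition profinite (G : topGroupType) : Prop :=
  [/\ compact [set: G], hausdorff_space G &
      forall U : set G, nbhs 1%g U ->
        exists2 H : subgroup G, open H & H `<=` U].

Definition pro_p (p : nat) (G : topGroupType) : Prop :=
  profinite G /\
  forall N : normalSubgroup G, open N ->
    exists k : nat, ([set: quotient_group N] #= `I_(p ^ k))%card.

Definition abelian_group (G : groupType) : Prop :=
  forall x y : G, (x * y = y * x)%g.

Definition converges_to_1 (X : Type) (G : topGroupType) (f : X -> G) : Prop :=
  forall U : set G, nbhs 1%g U -> finite_set [set x | ~ U (f x)].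

(** The free object, on a set converging to 1 (only finitely many elements lie
    outside a given neighbourhood of 1), in the category of abelian pro-p groups;
    explicitly, [A] is a power [Z_p^X] with the product topology. *)
Definition free_abelian_pro_p (p : nat) (A : topGroupType) : Prop :=
  [/\ pro_p p A, abelian_group A &
   exists (X : Type) (i : X -> A), converges_to_1 i /\
     forall B : topGroupType, pro_p p B -> abelian_group B ->
     forall f : X -> B, converges_to_1 f ->
       exists! F : A -> B,
         [/\ continuous F, {morph F : x y / (x * y)%g} & F \o i = f]].

(** [Z_p] is the inverse limit of the [Z/p^n]; the [n]-th component of a p-adic
    integer is given by its representative in [[0, p^n)]. *)
Record padic (p : nat) := Padic {
  padic_res :> nat -> int;
  padicP : forall n, padic_res n = (padic_res n.+1 %% (p ^ n)%N)%Z }.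

Section Padic.
Variable p : nat.
Implicit Types x y z : padic p.

Lemma padic_inj x y : (forall n, x n = y n) -> x = y.
Proof.
case: x y => [x xP] [y yP] /= /funext xy; rewrite -xy in yP *.
by congr Padic; exact: Prop_irrelevance.
Qed.

Lemma padic_mod x n : (x n %% (p ^ n)%N)%Z = x n.
Proof. by rewrite (padicP x) modz_mod. Qed.

Let modS (a : int) n :
  (a %% (p ^ n)%N = (a %% (p ^ n.+1)%N)%Z %% (p ^ n)%N)%Z.
Proof. by rewrite {1}(divz_eq a (p ^ n.+1)%N) expnS PoszM mulrA modzMDl. Qed.

Lemma padic_res_le x (m n : nat) :
  (m <= n)%N -> x m = (x n %% (p ^ m)%N)%Z.
Proof.
move=> mn; rewrite -(subnKC mn); elim: (n - m)%N => [|k IH].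
  by rewrite addn0 padic_mod.
rewrite IH addnS (padicP x (m + k)) expnD PoszM.
rewrite [in RHS](divz_eq (x (m + k).+1) ((p ^ m)%N%:Z * (p ^ k)%N%:Z)).
by rewrite [X in _ * X + _]mulrC mulrA modzMDl.
Qed.

Lemma padic_le x y (m n : nat) : (m <= n)%N -> x n = y n -> x m = y m.
Proof. by move=> mn xy; rewrite !(padic_res_le _ mn) xy. Qed.

HB.instance Definition _ := gen_eqMixin (padic p).
HB.instance Definition _ := gen_choiceMixin (padic p).

Let zero_subproof n : 0%Z = (0%Z %% (p ^ n)%N)%Z.
Proof. by rewrite mod0z. Qed.
Definition padic0 : padic p := Padic zero_subproof.

Let one_subproof n : (1 %% (p ^ n)%N = (1 %% (p ^ n.+1)%N)%Z %% (p ^ n)%N)%Z.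
Proof. exact: modS. Qed.
Definition padic1 : padic p := Padic one_subproof.

Let opp_subproof x n : ((- x n) %% (p ^ n)%N =
  ((- x n.+1) %% (p ^ n.+1)%N)%Z %% (p ^ n)%N)%Z.
Proof. by rewrite -modS (padicP x) modzNm. Qed.
Definition padic_opp x : padic p := Padic (opp_subproof x).

Let add_subproof x y n : ((x n + y n) %% (p ^ n)%N =
  ((x n.+1 + y n.+1) %% (p ^ n.+1)%N)%Z %% (p ^ n)%N)%Z.
Proof. by rewrite -modS (padicP x) (padicP y) modzDm. Qed.
Definition padic_add x y : padic p := Padic (add_subproof x y).

Let mul_subproof x y n : ((x n * y n) %% (p ^ n)%N =
  ((x n.+1 * y n.+1) %% (p ^ n.+1)%N)%Z %% (p ^ n)%N)%Z.
Proof. by rewrite -modS (padicP x) (padicP y) modzMm. Qed.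
Definition padic_mul x y : padic p := Padic (mul_subproof x y).

Let addA : associative padic_add.
Proof. by move=> x y z; apply/padic_inj => n /=; rewrite modzDmr modzDml addrA. Qed.

Let addC : commutative padic_add.
Proof. by move=> x y; apply/padic_inj => n /=; rewrite addrC. Qed.

Let add0 : left_id padic0 padic_add.
Proof. by move=> x; apply/padic_inj => n /=; rewrite add0r padic_mod. Qed.

Let addN : left_inverse padic0 padic_opp padic_add.
Proof. by move=> x; apply/padic_inj => n /=; rewrite modzDml addNr mod0z. Qed.

HB.instance Definition _ := GRing.isZmodule.Build (padic p) addA addC add0 addN.

Let mulA : associative padic_mul.
Proof. by move=> x y z; apply/padic_inj => n /=; rewrite modzMmr modzMml mulrA. Qed.

Let mulC : commutative padic_mul.
Proof. by move=> x y; apply/padic_inj => n /=; rewrite mulrC. Qed.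

Let mul1 : left_id padic1 padic_mul.
Proof. by move=> x; apply/padic_inj => n /=; rewrite modzMml mul1r padic_mod. Qed.

Let mulD : left_distributive padic_mul padic_add.
Proof.
by move=> x y z; apply/padic_inj => n /=; rewrite modzMml modzDm mulrDl.
Qed.

HB.instance Definition _ :=
  GRing.Zmodule_isComPzRing.Build (padic p) mulA mulC mul1 mulD.

Lemma padic_resD x y n : (x + y) n = ((x n + y n)%R %% (p ^ n)%N)%Z.
Proof. by []. Qed.

Lemma padic_resN x n : (- x) n = ((- x n)%R %% (p ^ n)%N)%Z.
Proof. by []. Qed.

Lemma padic_resM x y n : (x * y) n = ((x n * y n)%R %% (p ^ n)%N)%Z.
Proof. by []. Qed.

Lemma padic_res1 n : (1 : padic p) n = (1 %% (p ^ n)%N)%Z.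
Proof. by []. Qed.

(** The p-adic topology: the cosets [x + p^n Z_p] are a base of neighbourhoods
    of [x]. *)
HB.instance Definition _ := hasNbhs.Build (padic p)
  (fun x => filter_from setT (fun n => [set y : padic p | y n = x n])).

Let nbhs_filter x : ProperFilter (nbhs x).
Proof.
apply: filter_from_proper; last by move=> n _; exists x.
apply: filter_from_filter; first by exists 0%N.
move=> m n _ _; exists (maxn m n) => // y /= yx.
by split; apply: padic_le yx; rewrite ?leq_maxl ?leq_maxr.
Qed.

Let nbhs_singleton x (A : set (padic p)) : nbhs x A -> A x.
Proof. by move=> [n _]; apply. Qed.

Let nbhs_nbhs x (A : set (padic p)) : nbhs x A -> nbhs x (nbhs^~ A).
Proof. by move=> [n _ nA]; exists n => // y /= yx; exists n => // z /= zy; apply: nA; rewrite /= zy. Qed.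

HB.instance Definition _ := Nbhs_isNbhsTopological.Build (padic p)
  nbhs_filter nbhs_singleton nbhs_nbhs.

Definition one_units : set (padic p) :=
  [set u | exists z : padic p, u = 1 + p%:R * z].
End Padic.

(** In a pro-p group [h ^ a] is the limit of the powers of [h] with exponents
    the representatives of [a] modulo [p^n] (the default value [1] of [xget] is
    not used, as these powers converge). *)
Definition padic_expg (p : nat) (G : topGroupType) (h : G) (a : padic p) : G :=
  xget 1%g [set y : G | (h ^+ `|a n|%N)%g @[n --> \oo] --> y].

Record cyclotomicPair (p : nat) := CyclotomicPair {
  cyc_group :> topGroupType;
  cyc_pro_p : pro_p p cyc_group;
  theta : cyc_group -> padic p;
  theta_one_units : forall g, one_units (theta g);
  theta1 : theta 1%g = 1;
  thetaM : forall g h, theta (g * h)%g = theta g * theta h;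
  theta_continuous : continuous theta }.

Definition torsion_free_pair (p : nat) (P : cyclotomicPair p) : Prop :=
  forall (g : P) (n : nat), (0 < n)%N -> theta g ^+ n = 1 -> theta g = 1.

Section Kummerian.
Variables (p : nat) (P : cyclotomicPair p).
Local Open Scope group_scope.

Let theta_ker_subgroup : is_subgroup [set g : P | theta g = 1%R].
Proof.
split => [|x y /= x1 y1]; first exact: theta1.
by rewrite thetaM x1 mul1r -[RHS](theta1 P) -(mulgV y) thetaM y1 mul1r.
Qed.

Definition theta_ker : subgroup P := Subgroup theta_ker_subgroup.

Definition cyc_K : subgroup P := closed_gen
  [set padic_expg h (- theta g)%R * g * h * g^-1 |
     g in [set: P] & h in (theta_ker : set P)].

Let theta_conj (x g : P) : theta (x ^ g) = theta x.
Proof.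
have gV : (theta g^-1%g * theta g = 1)%R by rewrite -thetaM mulVg theta1.
by rewrite /conjg !thetaM mulrCA gV mulr1.
Qed.

Let conj_continuous (g : P) : continuous (fun x : P => x ^ g).
Proof.
have mulc (f f' : P -> P) : continuous f -> continuous f' ->
    continuous (fun x => f x * f' x).
  move=> cf cf' x U /(@mulg_continuous P (f x, f' x)) [[A B] /= [nA nB] sAB].
  have fA : nbhs x (f @^-1` A) by exact: cf.
  have fB : nbhs x (f' @^-1` B) by exact: cf'.
  by apply: filterS2 fA fB => y Ay By; exact: (sAB (f y, f' y)).
rewrite /conjg; apply: (mulc (fun=> g^-1)); first exact: cst_continuous.
by apply: (mulc id); [move=> x; exact: cvg_id | exact: cst_continuous].
Qed.

Let padic_expg_conj (h g : P) (a : padic p) :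
  (padic_expg h a) ^ g = padic_expg (h ^ g) a.
Proof.
have hP : hausdorff_space P by case: (cyc_pro_p P) => -[].
have cvgJ (k f y : P) : (k ^+ `|a n|%N)%g @[n --> \oo] --> y ->
    ((k ^ f) ^+ `|a n|%N)%g @[n --> \oo] --> y ^ f.
  move=> ky; under eq_fun do rewrite -conjXg.
  exact: (cvg_comp _ _ ky (@conj_continuous f y)).
rewrite /padic_expg; case: xgetP => [y _ hy|hN].
  apply/esym/xget_unique => [|z hz]; first exact: cvgJ.
  by apply: (cvg_unique hP) hz (cvgJ _ _ _ hy).
rewrite conj1g; case: xgetP => [y _ hy|//].
by exfalso; apply: (hN (y ^ g^-1)); rewrite -[h](conjgK g); exact: cvgJ.
Qed.

Lemma cyc_K_normal (x g : P) :
  subgroup_set cyc_K x -> subgroup_set cyc_K (x ^ g).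
Proof.
move=> Kx A [[sA cA] SA].
suff : [set y | A (y ^ g)] x by [].
apply: Kx; split; first split.
- split => [|y z /= Ay Az]; first by rewrite /= conj1g; exact: sA.1.
  by rewrite conjMg conjVg; exact: sA.2.
- exact: (@preimage_closed _ _ (fun y : P => y ^ g) A).
- move=> _ [k _ [h /= h1 <-]]; apply: SA; exists (k ^ g) => //.
  exists (h ^ g); first by rewrite /= theta_conj.
  by rewrite theta_conj !conjMg conjVg padic_expg_conj.
Qed.

(** [K(P)] is contained in [Ker theta], so its preimage under the inclusion of
    [Ker theta] is [K(P)] itself, as a normal subgroup of [Ker theta]. *)
Let cyc_K_ker_subgroup :
  is_subgroup [set u : subgroup_type theta_ker | subgroup_set cyc_K (val u)].
Proof.
split => [|u v /= Ku Kv]; first exact: subgroup1.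
exact: (subgroupP cyc_K).2.
Qed.

Let cyc_K_ker_normal (u v : subgroup_type theta_ker) :
  subgroup_set (Subgroup cyc_K_ker_subgroup) u ->
  subgroup_set (Subgroup cyc_K_ker_subgroup) (u ^ v).
Proof. exact: cyc_K_normal. Qed.

Definition cyc_K_ker : normalSubgroup (subgroup_type theta_ker) :=
  NormalSubgroup cyc_K_ker_normal.

Definition kummerian : Prop := free_abelian_pro_p p (quotient_group cyc_K_ker).
End Kummerian.

(** For a discrete module, joint continuity of the action amounts to the
    continuity of all the orbit maps. *)
Record discreteModule (G : topGroupType) := DiscreteModule {
  dm_sort :> zmodType;
  dm_act : G -> dm_sort -> dm_sort;
  dm_act1 : forall m, dm_act 1%g m = m;
  dm_actM : forall g h m, dm_act (g * h)%g m = dm_act g (dm_act h m);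
  dm_actD : forall g, {morph dm_act g : m n / m + n};
  dm_continuous : forall m,
    continuous (fun g => dm_act g m : discrete_topology dm_sort) }.

Record moduleHom (G : topGroupType) (M N : discreteModule G) := ModuleHom {
  mh_fun :> M -> N;
  mh_add : {morph mh_fun : m n / m + n};
  mh_act : forall g m, mh_fun (dm_act g m) = dm_act g (mh_fun m) }.

Lemma locally_constantP (G : topologicalType) (M : choiceType) (c : G -> M) :
  continuous (c : G -> discrete_topology M) <->
  forall g, \forall h \near g, c h = c g.
Proof.
split => cc g; first by have := cc g _ (discrete_set1 (c g : discrete_topology M)).
move=> U /principal_filterP Ucg.
by apply: filterS (cc g) => h; rewrite /= => ->.
Qed.

Section Cohomology.
Variables (G : topGroupType) (M : discreteModule G).
Local Open Scope quotient_scope.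

Let dm_act0 g : dm_act g (0 : M) = 0.
Proof. by apply: (addrI (dm_act g 0)); rewrite -dm_actD !addr0. Qed.

Let dm_actN g (m : M) : dm_act g (- m) = - dm_act g m.
Proof. by apply: (addrI (dm_act g m)); rewrite -dm_actD !subrr dm_act0. Qed.

Definition crossed_hom (c : G -> M) : Prop :=
  continuous (c : G -> discrete_topology M) /\
  forall g h, c (g * h)%g = c g + dm_act g (c h).

Definition Z1_pred : {pred G -> M} := fun c => `[< crossed_hom c >].

Let Z1_zmod_closed : zmod_closed Z1_pred.
Proof.
split; first apply/asboolP; first split.
- by apply/locally_constantP => g; exact: nearW.
- by move=> g h; rewrite /GRing.zero /= dm_act0 addr0.
move=> c d /asboolP [cc ch] /asboolP [dc dh]; apply/asboolP; split.
  move/locally_constantP in cc; move/locally_constantP in dc.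
  apply/locally_constantP => g; apply: filterS2 (cc g) (dc g) => h ch' dh'.
  by rewrite !fctE ch' dh'.
by move=> g h; rewrite !fctE ch dh dm_actD dm_actN opprD addrACA.
Qed.

HB.instance Definition _ := GRing.isZmodClosed.Build (G -> M) Z1_pred
  Z1_zmod_closed.

Record Z1 := MkZ1 { Z1_fun :> G -> M; Z1P : Z1_fun \in Z1_pred }.
HB.instance Definition _ := [isSub for Z1_fun].
HB.instance Definition _ := [Choice of Z1 by <:].
HB.instance Definition _ := [SubChoice_isSubZmodule of Z1 by <:].

Definition B1 : {pred Z1} :=
  fun c => `[< exists m : M, forall g, c g = dm_act g m - m >].

Let B1_zmod_closed : zmod_closed B1.
Proof.
split; first by apply/asboolP; exists 0 => g; rewrite dm_act0 subrr.
move=> c d /asboolP [m cm] /asboolP [n dn]; apply/asboolP; exists (m - n) => g.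
rewrite -[LHS]/(c g - d g) cm dn dm_actD dm_actN !opprD addrACA.
by congr (_ + _); rewrite -opprD.
Qed.

HB.instance Definition _ := GRing.isZmodClosed.Build Z1 B1 B1_zmod_closed.

Definition H1 : zmodType := Quotient.quot B1.
End Cohomology.

Section CohomologyMap.
Variables (G : topGroupType) (M N : discreteModule G) (f : moduleHom M N).
Local Open Scope quotient_scope.

Let Z1_map_subproof (c : Z1 M) : (f \o c) \in @Z1_pred G N.
Proof.
have /asboolP [cc ch] := Z1P c; apply/asboolP; split.
  move/locally_constantP in cc; apply/locally_constantP => g.
  by apply: filterS (cc g) => h /= ->.
by move=> g h /=; rewrite ch mh_add mh_act.
Qed.

Definition Z1_map (c : Z1 M) : Z1 N := MkZ1 (Z1_map_subproof c).

(** The map induced by [f] on cohomology: the class of [c] is sent to the class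
    of [f \o c], see [H1_map_pi]. *)
Definition H1_map (x : H1 M) : H1 N :=
  \pi_(Quotient.quot (@B1 G N)) (Z1_map (repr x)).

Lemma H1_map_pi (c : Z1 M) :
  H1_map (\pi_(Quotient.quot (@B1 G M)) c) =
  \pi_(Quotient.quot (@B1 G N)) (Z1_map c).
Proof.
apply/eqP; rewrite -Quotient.idealrBE.
have : repr (\pi_(Quotient.quot (@B1 G M)) c) - c \in @B1 G M.
  by rewrite Quotient.idealrBE reprK.
move=> /asboolP [m cm]; apply/asboolP; exists (f m) => g.
have f0 : f 0 = 0 by apply: (addrI (f 0)); rewrite -mh_add !addr0.
have fN (a : M) : f (- a) = - f a.
  by apply: (addrI (f a)); rewrite -mh_add !subrr.
rewrite -mh_act -fN -mh_add -cm.
by rewrite -[RHS]/(f (_ g - c g)) mh_add fN.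
Qed.
End CohomologyMap.

Section Twist.
Variables (p : nat) (p_pr : prime p) (P : cyclotomicPair p).

Let expn_gt1 n : (0 < n)%N -> (1 < p ^ n)%N.
Proof. by move=> n0; rewrite -(exp1n n) ltn_exp2r // prime_gt1. Qed.

Let intr_modZ (q : nat) (a : int) : (1 < q)%N ->
  ((a %% q)%Z)%:~R = a%:~R :> 'Z_q.
Proof.
move=> q1; have -> := congr1 (fun b : int => b%:~R : 'Z_q) (divz_eq a q).
rewrite [RHS]intrD [X in _ = X + _]intrM.
by rewrite -pmulrn (pchar_Zp q1) mulr0 add0r.
Qed.

Section Module.
Variables (n : nat) (n_gt0 : (0 < n)%N).
Local Notation M := 'Z_(p ^ n).

(** [Z/p^n(1)_theta] is ['Z_(p ^ n)], where [g] acts as multiplication by the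
    residue of [theta g] modulo [p^n]; [0 < n] is needed because ['Z_1] is [Z/2]. *)
Definition twist_act (g : P) (m : M) : M := (theta g n)%:~R * m.

Let act1 (m : M) : twist_act 1%g m = m.
Proof. by rewrite /twist_act theta1 padic_res1 intr_modZ ?expn_gt1 // mul1r. Qed.

Let actM (g h : P) (m : M) :
  twist_act (g * h)%g m = twist_act g (twist_act h m).
Proof.
by rewrite /twist_act thetaM padic_resM intr_modZ ?expn_gt1 // intrM mulrA.
Qed.

Let actD (g : P) : {morph twist_act g : m m' / m + m'}.
Proof. by move=> m m'; exact: mulrDr. Qed.

Let act_continuous (m : M) :
  continuous (fun g : P => twist_act g m : discrete_topology M).
Proof.
apply/locally_constantP => g.
have : nbhs (theta g) [set y : padic p | y n = theta g n] by exists n.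
move=> /(@theta_continuous _ P g); move=> nh.
have sub : [set h : P | theta h n = theta g n] `<=`
    [set h : P | twist_act h m = twist_act g m].
  by move=> h /= hg; rewrite /twist_act hg.
exact: filterS sub nh.
Qed.

Definition twist : discreteModule P :=
  DiscreteModule act1 actM actD act_continuous.
End Module.

Section Projection.
Variables (n : nat) (n_gt0 : (0 < n)%N).
Local Notation M := 'Z_(p ^ n).
Local Notation N := 'Z_(p ^ 1).

Definition twist_proj_fun (m : M) : N := (m : nat)%:R.

Let proj_nat (k : nat) : twist_proj_fun k%:R = k%:R.
Proof.
rewrite /twist_proj_fun val_Zp_nat ?expn_gt1 //.
have gt1 := expn_gt1 (ltn0Sn 0).
rewrite -(Zp_nat_mod gt1) -[in RHS](Zp_nat_mod gt1).
by rewrite modn_dvdm // dvdn_exp2l.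
Qed.

Let projD : {morph twist_proj_fun : a b / a + b}.
Proof.
move=> a b; rewrite -[a]natr_Zp -[b]natr_Zp -natrD !proj_nat.
exact: natrD.
Qed.

Let proj_act (g : P) (m : M) :
  twist_proj_fun (twist_act g m) = @twist_act 1 g (twist_proj_fun m).
Proof.
have proj_int (a : int) (b : M) :
    twist_proj_fun (a%:~R * b) = a%:~R * twist_proj_fun b.
  have proj_natM (k : nat) : twist_proj_fun (k%:R * b) = k%:R * twist_proj_fun b.
    by rewrite -[b]natr_Zp -natrM !proj_nat natrM.
  have proj0 : twist_proj_fun 0 = 0 by exact: (proj_nat 0).
  have projN c : twist_proj_fun (- c) = - twist_proj_fun c.
    by apply: (addrI (twist_proj_fun c)); rewrite -projD !subrr.
  case: a => k; first exact: proj_natM.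
  by rewrite NegzE !mulrNz !mulNr projN; congr (- _); exact: proj_natM.
rewrite /twist_act proj_int (padic_res_le _ n_gt0).
by rewrite intr_modZ ?expn_gt1.
Qed.

Definition twist_proj : moduleHom (twist n_gt0) (twist (ltn0Sn 0)) :=
  @ModuleHom P (twist n_gt0) (twist (ltn0Sn 0)) twist_proj_fun projD proj_act.
End Projection.
End Twist.

(* Main.v *)
From HB Require Import structures.
Require Import Defs.
From mathcomp Require Import all_boot all_order all_algebra.
From mathcomp Require all_fingroup all_solvable.
From mathcomp Require Import all_classical topology.
From mathcomp Require Import ring zify.

Set Implicit Arguments.
Unset Strict Implicit.
Unset Printing Implicit Defensive.

Local Open Scope classical_set_scope.

(** Write [N = Ker theta], [A = N / K(P)] and [M_n = Z/p^n(1)_theta]; on [A] the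
    group acts by [g h g^-1 = h^(theta g)].

    Since [Im theta] is torsion free it is procyclic: there is a procyclic closed
    subgroup [T] mapped isomorphically onto [Im theta], so [P] is a semidirect
    product of [N] and [T]. Hence every continuous homomorphism [A -> Z/p^n]
    extends to a crossed homomorphism [P -> M_n] trivial on [T], while conversely a
    crossed homomorphism restricts to [N] and kills [K(P)]. A homomorphism
    [P -> Z/p] trivial on [N] always lifts to [M_n], through multiples of the
    crossed homomorphism [(theta g - 1) / p^k]. So surjectivity on [H^1] says
    exactly that characters [A -> Z/p] lift to [Z/p^n] for all [n].

    If [A] is free they lift by the universal property. Conversely [A] is finitely
    generated; an irredundant generating family [h_i] has a family of characters
    [A -> Z/p] that is nonzero exactly on the diagonal, and its lifts show that
    a product of powers of the [h_i] close to [1] has exponents divisible by a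
    large power of [p]. The closure of the graph
    [prod h_i^m_i |-> prod f_i^m_i] is therefore the graph of a continuous
    homomorphism, for all values [f_i] in an abelian pro-p group. *)

(** * Finite p-groups and their characters *)

(* The imports are confined to a module: [fingroup] redefines [quotient_group],
   [repr] and [normalP]. *)
Module FiniteGroups.
Import all_fingroup all_solvable.

(** The finiteness proof is a parameter of the alias, so that the finite group structure can be
    inferred from the type alone. *)
Definition fin_group (Q : groupType) (finQ : finite_set [set: Q]) : Type := Q.

Section FinGroup.
Variables (Q : groupType) (finQ : finite_set [set: Q]).
Local Notation F := (fin_group finQ).

HB.instance Definition _ := Group.on F.

Let enumF : seq F := sval (cid ((finite_seqP [set: Q]).1 finQ)).

Let mem_enumF (x : F) : x \in undup enumF.
Proof.
have e : [set: Q] = [set` enumF] by rewrite /enumF; case: cid.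
by rewrite mem_undup; have : [set` enumF] x by rewrite -e.
Qed.

Let pickleF (x : F) := index x (undup enumF).
Let unpickleF n : option F := ohead (drop n (undup enumF)).

Let pickleFK : pcancel pickleF unpickleF.
Proof.
move=> x; rewrite /pickleF /unpickleF (drop_nth x) ?index_mem ?mem_enumF //=.
by rewrite nth_index ?mem_enumF.
Qed.

HB.instance Definition _ := isCountable.Build F pickleFK.

Let enumFP : Finite.axiom (undup enumF).
Proof. by move=> x; rewrite count_uniq_mem ?undup_uniq // mem_enumF. Qed.

HB.instance Definition _ := isFinite.Build F enumFP.
End FinGroup.

Lemma card_eq_finType (T : finType) (n : nat) :
  ([set: T] #= `I_n)%card <-> #|T| = n.
Proof.
have cT : ([set: T] #= `I_#|T|)%card.
  apply/card_set_bijP; exists (fun x => val (enum_rank x)); split.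
  - by move=> x _ /=.
  - by move=> x y _ _ /val_inj /enum_rank_inj.
  - by move=> i /= iT; exists (enum_val (Ordinal iT)); rewrite // enum_valK.
split=> [|<- //].
move=> Tn; apply/card_eq_II; apply: card_eq_trans Tn.
by rewrite card_eq_sym.
Qed.

Section Groups.
Variables (p : nat) (p_pr : prime p).
Local Open Scope group_scope.

Lemma card_expg (Q : groupType) (n : nat) (x : Q) :
  ([set: Q] #= `I_n)%card -> x ^+ n = 1.
Proof.
move=> Qn; have finQ : finite_set [set: Q] by apply/finite_setP; exists n.
have /card_eq_finType <- : ([set: fin_group finQ] #= `I_n)%card by [].
have := @expg_cardG (fin_group finQ) [set: fin_group finQ]%G x (finset.in_setT _).
by rewrite cardsT.
Qed.

(** From exponents to the order by Cauchy's theorem: a prime [q] dividing the order is the order of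
    some element, hence divides a power of [p]. *)
Lemma card_p_groupP (Q : groupType) :
  (exists k, ([set: Q] #= `I_(p ^ k))%card) <->
  finite_set [set: Q] /\ forall x : Q, exists m, (x ^+ (p ^ m) = 1)%g.
Proof.
split=> [[k Qk]|[finQ Qp]].
  by split=> [|x]; [apply/finite_setP | exists k; exact: card_expg];
    exists (p ^ k)%N.
have /p_natP[k Qk] : p.-nat #|[set: fin_group finQ]%G|.
  apply/pnatP => // q q_pr qQ.
  have [x _ ox] := @Cauchy (fin_group finQ) q [set: fin_group finQ]%G q_pr qQ.
  have [m xm] := Qp x.
  have : #[x] %| p ^ m by rewrite order_dvdn; apply/eqP; exact: xm.
  by rewrite ox Euclid_dvdX // dvdn_prime2 // inE => /andP[].
exists k; change ([set: fin_group finQ] #= `I_(p ^ k))%card.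
by apply/card_eq_finType; rewrite -Qk cardsT.
Qed.

(** A maximal subgroup [L] containing [M] is normal of index [p], so the quotient by [L] is cyclic
    of order [p]; [f] reads the exponent of a class with respect to a generator [y]. *)
Lemma p_group_char (Q : finGroupType) (M : {group Q}) :
  p.-group [set: Q]%G -> M \proper [set: Q]%G ->
  exists f : Q -> 'Z_p, [/\ forall x y, f (x * y) = (f x + f y)%R,
    forall x, x \in M -> f x = 0%R & exists x, f x != 0%R].
Proof.
move=> pQ; move/(@maxgroup_exists _ (fun H : {group Q} => H \proper [set: Q]%G%G)).
move=> [L maxL sML].
have nLQ : L <| [set: Q]%G := p_maximal_normal pQ maxL.
have iL := p_maximal_index pQ maxL.
have cardL : #|[set: Q]%G / L| = p by rewrite card_quotient ?normal_norm.
have /cyclicP[y Ly] : cyclic ([set: Q]%G / L) by rewrite prime_cyclic ?cardL.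
have oy : #[y] = p by rewrite orderE -Ly.
have /all_sig[i iP] x : {i : nat | coset L x = y ^+ i}.
  apply/cid; have : coset L x \in <[y]> by rewrite -Ly mem_quotient ?inE.
  by move/cycleP.
have NL x : x \in 'N(L) by apply: (fintype.subsetP (normal_norm nLQ)); rewrite inE.
have p1 := prime_gt1 p_pr.
have iE x k : coset L x = y ^+ k -> ((i x)%:R = k%:R :> 'Z_p)%R.
  move=> xk; apply/val_inj; rewrite /= !val_Zp_nat //.
  by have := eq_expg_mod_order y (i x) k; rewrite oy -iP xk eqxx => /esym/eqP.
exists (fun x => (i x)%:R)%R; split=> [x x'|x Mx|].
- by rewrite -GRing.natrD; apply: iE; rewrite morphM ?NL //= !iP expgnDr.
- by rewrite (iE x 0) // expg0; apply: coset_id; exact: (fintype.subsetP sML).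
- have [_ [z _ zL]] := properP (maxgroupp maxL).
  exists z; apply: contra zL => /eqP iz.
  apply: (coset_idr (NL z)); rewrite iP; apply/eqP.
  rewrite -order_dvdn oy; move/(congr1 val): iz; rewrite /= val_Zp_nat //.
  by move/eqP.
Qed.
Lemma p_group_charP (Q : groupType) (H : subgroup Q) (x : Q) :
  (exists k, ([set: Q] #= `I_(p ^ k))%card) -> ~ subgroup_set H x ->
  exists f : Q -> 'Z_p, [/\ forall x y, f (x * y) = (f x + f y)%R,
    forall x, subgroup_set H x -> f x = 0%R & exists x, f x != 0%R].
Proof.
move=> [k Qk] Hx; have finQ : finite_set [set: Q].
  by apply/finite_setP; exists (p ^ k)%N.
pose M := [set y : fin_group finQ | `[< subgroup_set H y >]]%SET.
have gM : group_set M.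
  apply/group_setP; split=> [|y z]; rewrite !inE.
    by apply/asboolP; exact: Defs.subgroup1.
  by move=> /asboolP Hy /asboolP Hz; apply/asboolP; exact: subgroupM.
have pQ : p.-group [set: fin_group finQ]%G.
  have /card_eq_finType Qk' : ([set: fin_group finQ] #= `I_(p ^ k))%card by [].
  by rewrite /pgroup cardsT Qk' pnatX pnat_id.
have [|f [fM f0 fx]] := @p_group_char (fin_group finQ) (Group gM) pQ.
  apply/properP; split; first by apply/fintype.subsetP => y; rewrite !inE.
  by exists x; rewrite !inE //; apply/asboolP.
exists f; split=> // y Hy; apply: f0.
by rewrite inE; apply/asboolP.
Qed.
End Groups.
End FiniteGroups.
Import FiniteGroups.

(** * p-adic integers *)

Section PadicArithmetic.
Variables (p : nat) (p_pr : prime p).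
Import GRing.Theory.
Local Open Scope ring_scope.
Implicit Types x y z u : padic p.

Lemma padic_resX x n j : (x ^+ j) n = (x n ^+ j %% (p ^ n)%N)%Z.
Proof.
elim: j => [|j IH]; first by rewrite !expr0 padic_res1.
by rewrite !exprS padic_resM IH modzMmr.
Qed.

Lemma padic_res_nat j n : (j%:R : padic p) n = (j%:Z %% (p ^ n)%N)%Z.
Proof.
elim: j => [|j IH]; first by rewrite mod0z.
by rewrite -[in LHS]addn1 natrD padic_resD IH padic_res1 modzDm -addn1 PoszD.
Qed.

Let pn_gt0 n : (0 < (p ^ n)%N%:Z :> int).
Proof. by rewrite ltz_nat expn_gt0 prime_gt0. Qed.

Let pn_neq0 n : ((p ^ n)%N%:Z != 0 :> int).
Proof. by rewrite eqz_nat -lt0n expn_gt0 prime_gt0. Qed.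

Lemma padic_res_ge0 x n : 0 <= x n.
Proof. by rewrite -padic_mod modz_ge0. Qed.

Lemma padic_res_eq0P x n : x n = 0 <-> exists z, x = (p ^ n)%N%:R * z.
Proof.
split=> [xn0|[z ->]]; last first.
  by rewrite padic_resM padic_res_nat modzz mul0r mod0z.
have dv m : ((p ^ n)%N %| x (m + n)%N)%Z.
  by apply/dvdz_mod0P; rewrite -padic_res_le ?leq_addl.
(* Division by [p^n] loses [n] digits, so the residue of the quotient modulo [p^m] comes from that
   of [x] modulo [p^(m+n)]. *)
have zP m : ((x (m + n)%N) %/ (p ^ n)%N =
    (x (m.+1 + n)%N %/ (p ^ n)%N)%Z %% (p ^ m)%N)%Z.
  have e : x (m + n)%N = (x (m.+1 + n)%N %% (p ^ (m + n))%N)%Z.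
    by apply: padic_res_le; rewrite addSn.
  have /dvdzP[q qE] := dv m.+1.
  rewrite e qE expnD PoszM -mulz_modl // mulzK //.
  by rewrite mulzK.
exists (Padic zP); apply: padic_inj => m.
rewrite padic_resM padic_res_nat modzMml /= mulrC divzK //.
by rewrite -(padic_res_le x) // leq_addr.
Qed.

Lemma padic_res_eqP x y n : x n = y n <-> exists z, x - y = (p ^ n)%N%:R * z.
Proof.
rewrite -padic_res_eq0P padic_resD padic_resN modzDmr; split => [->|].
  by rewrite subrr mod0z.
move=> /dvdz_mod0P; rewrite -eqz_mod_dvd => /eqP.
by rewrite !padic_mod.
Qed.

Lemma padic_mulpX_inj n : injective (fun z : padic p => (p ^ n)%N%:R * z).
Proof.
move=> x y xy; apply/eqP; rewrite -subr_eq0; apply/eqP/padic_inj => m.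
have e : (p ^ n)%N%:R * (x - y) = 0 by rewrite mulrBr xy subrr.
move: (x - y) e => z e; change (z m = 0).
have : ((p ^ n)%N%:R * z) (n + m)%N = 0 by rewrite e.
rewrite padic_resM padic_res_nat modzMml => /dvdz_mod0P.
rewrite expnD PoszM dvdz_mul2l // => /dvdz_mod0P.
by rewrite -padic_res_le // leq_addl.
Qed.

Lemma padic_res_small x : x 0 = 0.
Proof. by rewrite -padic_mod expn0 modz1. Qed.

Lemma padic_mod1 x : (x 1%N %% p)%Z = x 1%N.
Proof. by have := padic_mod x 1%N; rewrite expn1. Qed.

Lemma padic_dvdp_neq1 x n : x n != (1 : padic p) n -> (0 < n)%N.
Proof. by case: n => //; rewrite !padic_res_small eqxx. Qed.

Lemma expr1D x j : exists y, (1 + x) ^+ j = 1 + j%:R * x + x ^+ 2 * y.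
Proof.
elim: j => [|j [y yE]]; first by exists 0; rewrite expr0; ring.
exists (j%:R + y + x * y); rewrite exprS yE -natr1; ring.
Qed.

(** A nonzero residue modulo [p] is invertible there; this condition plays the role of being a unit
    throughout. *)
Lemma padic_unit_mulr u x : u 1%N != 0 -> (u * x) 1%N = 0 -> x 1%N = 0.
Proof.
rewrite padic_resM expn1 => u0 /dvdz_mod0P.
have cpu : coprimez p (u 1%N).
  rewrite coprimezE absz_nat prime_coprime //; apply: contra u0 => pu.
  by rewrite -padic_mod1; apply/eqP/dvdz_mod0P.
by rewrite Gauss_dvdzr // => /dvdz_mod0P; rewrite padic_mod1.
Qed.

Lemma padic_unit_div u x : u 1%N != 0 ->
  exists i : nat, (i%:R * u : padic p) 1%N = x 1%N.
Proof.
move=> u0; have cpu : coprimez (u 1%N) p.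
  rewrite coprimez_sym coprimezE absz_nat prime_coprime //.
  apply: contra u0 => pu.
  by rewrite -padic_mod1; apply/eqP/dvdz_mod0P.
have /coprimezP[[a b] /= ab] := cpu.
exists `|(a * x 1%N %% p)%Z|%N.
rewrite padic_res_nat expn1 modzMml gez0_abs ?modz_ge0 //; last first.
  by rewrite -(expn1 p); exact: pn_neq0.
rewrite modzMml mulrAC.
have -> : a * u 1%N * x 1%N = (- b * x 1%N) * p + x 1%N.
  rewrite -[X in _ + X]mul1r -ab; ring.
by rewrite modzMDl padic_mod1.
Qed.

(** Lifting the exponent; [k >= 2] makes the quadratic remainder negligible,
    also for [p = 2]. *)
Lemma padic_lte k u m : (2 <= k)%N -> u 1%N != 0 ->
  exists2 v : padic p, v 1%N != 0 & (1 + (p ^ k)%N%:R * u) ^+ (p ^ m) =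
                        1 + (p ^ (k + m))%N%:R * v.
Proof.
move=> k2 u0; elim: m => [|m [v v0 vE]].
  by exists u; rewrite // expr1 addn0.
rewrite expnSr exprM vE.
have [y ->] := expr1D ((p ^ (k + m))%N%:R * v) p.
exists (v + p%:R * ((p ^ (k + m - 2))%N%:R * v ^+ 2 * y)).
  rewrite (_ : padic_res _ _ = v 1%N) //; apply/padic_res_eqP.
  by exists ((p ^ (k + m - 2))%N%:R * v ^+ 2 * y); rewrite addrC addKr expn1.
rewrite mulrDr addrA addnS; congr (1 + _ + _).
  by rewrite mulrA -natrM expnS.
have e : ((p ^ (k + m))%N%:R ^+ 2 : padic p) =
    (p ^ (k + m).+1)%N%:R * (p%:R * (p ^ (k + m - 2))%N%:R).
  rewrite -natrX -!natrM -expnS -expnD -expnM; congr (_ ^ _)%N%:R; lia.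
by rewrite exprMn e !mulrA.
Qed.

(** Induction on [l <= m]: if [j = p^l j'] with [l < m], the power is [1 + p^(k+l) v j'] modulo
    [p^(k+l+1)] with [v] a unit, so being [1] modulo [p^(k+m)] forces [p] to divide [j']. *)
Lemma padic_order_dvd k u m j : (2 <= k)%N -> u 1%N != 0 ->
  ((1 + (p ^ k)%N%:R * u) ^+ j) (k + m)%N = (1 : padic p) (k + m)%N ->
  (p ^ m %| j)%N.
Proof.
move=> k2 u0 /padic_res_eqP[z zE].
suff dvj l : (l <= m)%N -> (p ^ l %| j)%N by exact: dvj.
elim: l => [|l IH] lm; first by rewrite expn0 dvd1n.
have /dvdnP[j' jE] := IH (ltnW lm).
have [v v0 vE] := padic_lte l k2 u0.
move: zE; rewrite jE mulnC exprM vE.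
have [y ->] := expr1D ((p ^ (k + l))%N%:R * v) j'.
move=> zE; have e : v * j'%:R = p%:R *
    ((p ^ (m - l.+1))%N%:R * z - (p ^ (k + l - 1))%N%:R * v ^+ 2 * y).
  apply: (@padic_mulpX_inj (k + l)); rewrite /=.
  have e1 : (p ^ (k + m))%N%:R =
      (p ^ (k + l))%N%:R * p%:R * (p ^ (m - l.+1))%N%:R :> padic p.
    by rewrite -!natrM -expnSr -expnD; congr (_ ^ _)%N%:R; lia.
  have e2 : (p ^ (k + l))%N%:R ^+ 2 =
      (p ^ (k + l))%N%:R * p%:R * (p ^ (k + l - 1))%N%:R :> padic p.
    by rewrite -natrX -!natrM -expnSr -expnD -expnM; congr (_ ^ _)%N%:R; lia.
  transitivity ((p ^ (k + m))%N%:R * z - (p ^ (k + l))%N%:R ^+ 2 * v ^+ 2 * y).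
    rewrite -zE; ring.
  rewrite e1 e2; ring.
have : (v * j'%:R) 1%N = 0.
  by apply/padic_res_eq0P; rewrite e expn1; eexists.
move/(padic_unit_mulr v0); rewrite padic_res_nat expn1 => /dvdz_mod0P.
by rewrite dvdzE /= expnSr => pj'; apply: dvdn_mul.
Qed.

(** Digits are corrected one at a time: a further factor with exponent [p^m i] changes only the
    digits from position [k + m] on, and [i] is chosen to match the next one. Hence the powers of
    [1 + p^k u] are dense in [1 + p^k Z_p]. *)
Lemma padic_approx k u x m : (2 <= k)%N -> u 1%N != 0 ->
  x k = (1 : padic p) k ->
  exists j, ((1 + (p ^ k)%N%:R * u) ^+ j) (k + m)%N = x (k + m)%N.
Proof.
move=> k2 u0 xk; elim: m => [|m [j jE]].
  by exists 0%N; rewrite addn0 expr0 xk.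
have [v v0 vE] := padic_lte m k2 u0.
have /padic_res_eqP[z zE] := jE.
set a := _ ^+ j in jE zE *.
have a0 : a 1%N = (1 : padic p) 1%N.
  by rewrite (padic_le _ jE) ?(padic_le _ xk) //; lia.
have [i iE] := padic_unit_div (- z) v0.
exists (j + p ^ m * i)%N; rewrite exprD exprM vE -/a.
have [y ->] := expr1D ((p ^ (k + m))%N%:R * v) i.
apply/padic_res_eqP; rewrite addnS expnS natrM.
have /padic_res_eqP[w wE] : (a * (i%:R * v)) 1%N = (- z) 1%N.
  by rewrite padic_resM a0 iE padic_res1 expn1 modzMml mul1r padic_mod1.
exists (w + a * v ^+ 2 * y * (p ^ (k + m - 1))%N%:R).
have e : (p ^ (k + m))%N%:R ^+ 2 =
    p%:R * (p ^ (k + m))%N%:R * (p ^ (k + m - 1))%N%:R :> padic p.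
  by rewrite -natrX -!natrM -expnS -expnD -expnM; congr (_ ^ _)%N%:R; lia.
transitivity (a - x + (p ^ (k + m))%N%:R * (a * (i%:R * v)) +
    (p ^ (k + m))%N%:R ^+ 2 * (a * v ^+ 2 * y)); first ring.
have wE' : z + a * (i%:R * v) = (p ^ 1)%N%:R * w by rewrite -wE; ring.
rewrite zE -mulrDr wE' e expn1; ring.
Qed.
End PadicArithmetic.

(** * Topological groups and pro-p groups *)

Section TopologicalGroups.
Implicit Types G : topGroupType.
Local Open Scope group_scope.

Lemma continuous_mulg (T : topologicalType) G (f g : T -> G) :
  continuous f -> continuous g -> continuous (fun x => f x * g x).
Proof.
move=> cf cg x; apply: (continuous_comp (f := fun x => (f x, g x))
  (g := fun xy : G * G => xy.1 * xy.2)); last exact: mulg_continuous.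
by apply: cvg_pair; [exact: cf | exact: cg].
Qed.

Lemma continuous_invg (T : topologicalType) G (f : T -> G) :
  continuous f -> continuous (fun x => (f x)^-1).
Proof.
by move=> cf x; apply: continuous_comp; [exact: cf | exact: invg_continuous].
Qed.

Lemma continuous_mull G (a : G) : continuous (fun x => a * x).
Proof.
apply: (@continuous_mulg G G (fun=> a) id); first exact: cst_continuous.
by move=> x; exact: cvg_id.
Qed.

Lemma continuous_mulr G (a : G) : continuous (fun x => x * a).
Proof.
apply: (@continuous_mulg G G id (fun=> a)); last exact: cst_continuous.
by move=> x; exact: cvg_id.
Qed.

Lemma nbhs_mull G (a x : G) (U : set G) :
  nbhs (a * x) U <-> nbhs x [set y | U (a * y)].
Proof.
split=> nU; first exact: (@continuous_mull G a x U nU).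
have := @continuous_mull G a^-1 (a * x) [set y | U (a * y)].
rewrite mulKg => /(_ nU) nV.
have {nV} : nbhs (a * x) [set z | U (a * (a^-1 * z))] by [].
by apply: filterS => y /=; rewrite mulVKg.
Qed.

Lemma nbhs_transl G (x : G) (U : set G) :
  nbhs x U <-> nbhs 1 [set y | U (x * y)].
Proof. by rewrite -nbhs_mull mulg1. Qed.

Lemma subgroup_openP G (H : subgroup G) : open H <-> nbhs 1 (H : set G).
Proof.
split=> [oH|nH].
  by apply: open_nbhs_nbhs; split=> //; exact: subgroup1.
rewrite openE => x Hx; apply/nbhs_transl; apply: filterS nH => y Hy.
exact: subgroupM.
Qed.

Lemma open_subgroup_closed G (H : subgroup G) : open H -> closed H.
Proof.
move=> /subgroup_openP nH x clx.
have /clx [y [Hy /= Hxy]] : nbhs x [set y | subgroup_set H (x^-1 * y)].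
  by apply/nbhs_transl; apply: filterS nH => z; rewrite /= mulKg.
by rewrite -[x]invgK -(mulgK y x^-1); apply/subgroupV/subgroupM => //; exact: subgroupV.
Qed.

Lemma closed_preimage (S T : topologicalType) (f : S -> T) (D : set T) :
  continuous f -> closed D -> closed (f @^-1` D).
Proof. by move=> /continuous_closedP; exact. Qed.

Lemma closed_gen_closed G (S : set G) : closed (closed_gen S).
Proof.
rewrite /= /closed_gen_set /smallest; apply: closed_bigI => A [[_ ?] _] //.
Qed.

Lemma closed_gen_sub G (S : set G) : S `<=` closed_gen S.
Proof. by move=> x Sx A [_]; exact. Qed.

Lemma closed_gen_min G (S : set G) (H : subgroup G) :
  closed H -> S `<=` H -> closed_gen S `<=` H.
Proof. by move=> cH SH x; apply; split=> //; split=> //; exact: subgroupP. Qed.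

Lemma homV (G H : groupType) (f : G -> H) :
  {morph f : x y / x * y} -> forall x, f x^-1 = (f x)^-1.
Proof.
move=> fM; have f1 : f 1 = 1 by apply: (mulgI (f 1)); rewrite -fM !mulg1.
by move=> x; apply: (mulgI (f x)); rewrite -fM !mulgV.
Qed.

Lemma hom1 (G H : groupType) (f : G -> H) :
  {morph f : x y / x * y} -> f 1 = 1.
Proof. by move=> fM; apply: (mulgI (f 1)); rewrite -fM !mulg1. Qed.

Lemma homX (G H : groupType) (f : G -> H) :
  {morph f : x y / x * y} -> forall x n, f (x ^+ n) = (f x) ^+ n.
Proof.
by move=> fM x; elim=> [|n IH]; rewrite ?expgS ?fM ?IH // !expg0 hom1.
Qed.

Lemma compact_mulset G (A B : set G) : compact A -> compact B ->
  compact [set x * y | x in A & y in B].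
Proof.
move=> cA cB; have := compact_setX cA cB.
move=> /(continuous_compact (f := fun xy : G * G => xy.1 * xy.2)).
have -> : [set x * y | x in A & y in B] =
    (fun xy : G * G => xy.1 * xy.2) @` (A `*` B).
  apply/seteqP; split=> [_ [x Ax [y By <-]]|_ [[x y] [/= Ax By] <-]].
    by exists (x, y).
  by exists x => //; exists y.
by apply; apply: continuous_subspaceT; exact: mulg_continuous.
Qed.

Lemma compact_discrete_finite (T : topologicalType) :
  compact [set: T] -> (forall x : T, open [set x]) -> finite_set [set: T].
Proof.
move=> cT oT; apply: contrapT => infT.
(* The cofinite filter of an infinite space: its cluster point would meet the complement of its own
   open singleton. *)
pose F : set_system T := [set A | finite_set (~` A)].
have F_proper : ProperFilter F.
  split; first by rewrite /F /= setC0.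
  split; rewrite /F /=.
  - by change (finite_set (~` [set: T])); rewrite setCT; exact: finite_set0.
  - move=> A B fA fB; change (finite_set (~` (A `&` B))).
    by rewrite setCI finite_setU; split.
  - by move=> A B /subsetC AB; apply: sub_finite_set.
have [x [_ clx]] := cT F F_proper filterT.
have [y [yx]] : (~` [set x]) `&` [set x] !=set0.
  apply: clx; last exact: open_nbhs_nbhs.
  by rewrite /F /= setCK; exact: finite_set1.
exact: yx.
Qed.
End TopologicalGroups.

(** * Open normal subgroups and a criterion for pro-p groups *)

Section ProP.
Variables (p : nat) (p_pr : prime p).
Implicit Types G : topGroupType.
Local Open Scope group_scope.

(** The intersection [C] of the conjugates of [H] is open by a tube argument: [x ^ g'] lies in [H]
    for [x] near [1] and [g'] near [g], and compactness of [G] gives one neighbourhood of [1] that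
    works for all [g]. *)
Lemma compact_normal_core G (H : subgroup G) : compact [set: G] -> open H ->
  exists2 N : normalSubgroup G, open N & N `<=` H.
Proof.
move=> cG oH; set C := [set x : G | forall g, subgroup_set H (x ^ g)].
have C_sub : is_subgroup C.
  split=> [g|x y Cx Cy g]; first by rewrite conj1g; exact: subgroup1.
  by rewrite conjMg conjVg; apply: (subgroupP H).2.
have C_norm x y : subgroup_set (Subgroup C_sub) x ->
    subgroup_set (Subgroup C_sub) (x ^ y).
  by move=> Cx g; rewrite -conjgM; exact: Cx.
exists (NormalSubgroup C_norm); last by move=> x /(_ 1); rewrite conjg1.
apply/subgroup_openP => /=.
have cJ : continuous (fun gx : G * G => gx.2 ^ gx.1).
  rewrite /conjg; apply: continuous_mulg.
    apply: continuous_invg => x; exact: cvg_fst.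
  by apply: continuous_mulg => x; [exact: cvg_snd | exact: cvg_fst].
have near1 (g : G) : [set: G] g ->
    \forall g' \near g & x \near (1 : G), subgroup_set H (x ^ g').
  move=> _; have := cJ (g, 1) H => /=; apply.
  by rewrite conj1g; exact/subgroup_openP.
have := (compact_near_coveringP [set: G]).1 cG G (nbhs 1)
  (fun x g => subgroup_set H (x ^ g)) _ near1.
move=> /(_ (nbhs_filter _)) nC; apply: filterS nC => x Cx g; exact: Cx.
Qed.

Lemma finite_quotient G (N : normalSubgroup G) :
  compact [set: G] -> open N -> finite_set [set: quotient_group N].
Proof.
move=> cG oN; apply: compact_discrete_finite.
  have <- : @coset_proj G N @` setT = setT.
    apply/seteqP; split=> // x _; exists (repr x) => //; exact: reprK.
  apply: continuous_compact => //.
  by apply: continuous_subspaceT; exact: coset_proj_continuous.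
move=> x; rewrite -[x]reprK; set y := repr x.
change (open (@coset_proj G N @^-1` [set coset_proj N y])).
have -> : @coset_proj G N @^-1` [set coset_proj N y] =
    (fun z => y^-1 * z) @^-1` N.
  by apply/seteqP; split=> z /= => [/esym|] /eq_cosetP // ->.
by apply: open_comp => // z _; exact: continuous_mull.
Qed.

(** In this form, where no quotient is counted, the pro-p condition passes easily to subgroups and
    quotients. The link is that a finite group has [p]-power order exactly when all its elements
    do. *)
Lemma pro_pP G : pro_p p G <-> profinite G /\
  forall (U : set G) x, nbhs 1 U -> exists m, U (x ^+ (p ^ m)).
Proof.
split=> [[prG pG]|[prG pG]]; split=> //.
  move=> U x nU; have [cG hG /(_ _ nU)[H oH HU]] := prG.
  have [N oN NH] := compact_normal_core cG oH.
  have /(card_p_groupP p_pr)[_ /(_ (coset_proj N x))[m xm]] := pG N oN.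
  exists m; apply/HU/NH; rewrite -[_ ^+ _]mul1g -[X in X * _]invg1.
  by apply/eq_cosetP; rewrite (homX (@quotient_group_mulE G N)) xm.
move=> N oN; have [cG hG _] := prG.
apply/card_p_groupP => //; split=> [|x]; first exact: finite_quotient.
have /subgroup_openP/(pG _ (repr x))[m Nm] := oN.
exists m; rewrite -[x]reprK -(homX (@quotient_group_mulE G N)).
by apply/esym/eq_cosetP; rewrite invg1 mul1g.
Qed.
End ProP.

(** * p-adic powers, closed subgroups and quotients of pro-p groups *)

Section ProPConstructions.
Variables (p : nat) (p_pr : prime p).
Implicit Types G : topGroupType.
Local Open Scope group_scope.

(** The quotient by [N] has finite order [p^k], which makes the exponent uniform in [x]. *)
Lemma pro_p_expn G (U : set G) : pro_p p G -> nbhs 1 U ->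
  exists N : normalSubgroup G, [/\ open N, N `<=` U &
    exists k, forall x, subgroup_set N (x ^+ (p ^ k))].
Proof.
move=> [[cG hG bG] pG] /bG[H oH HU].
have [N oN NH] := compact_normal_core cG oH.
exists N; split=> //; first exact: subset_trans HU.
have [k Nk] := pG N oN; exists k => x.
rewrite -[_ ^+ _]mul1g -[X in X * _]invg1; apply/eq_cosetP.
rewrite (homX (@quotient_group_mulE G N)).
by rewrite (card_expg _ Nk).
Qed.

Lemma subgroupX (G : groupType) (H : subgroup G) x n :
  subgroup_set H x -> subgroup_set H (x ^+ n).
Proof.
move=> Hx; elim: n => [|n IH]; first by rewrite expg0; exact: subgroup1.
by rewrite expgS; exact: subgroupM.
Qed.

Lemma expg_modn (G : groupType) (H : subgroup G) (x : G) q i j :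
  subgroup_set H (x ^+ q) -> i = j %[mod q] ->
  subgroup_set H ((x ^+ i)^-1 * x ^+ j).
Proof.
wlog ij : i j / (i <= j)%N => [W Hx|Hx /eqP].
  have [ij /W|/ltnW ji /esym /W] := leqP i j; first exact.
  move=> /(_ ji Hx) /subgroupV.
  by rewrite invgM invgK.
rewrite eq_sym eqn_mod_dvd // => /dvdnP[d jiE].
rewrite -(subnKC ij) expgnDr mulKg jiE mulnC expgnA.
exact: subgroupX.
Qed.

Lemma padic_abs_mod (a : padic p) m n : (m <= n)%N ->
  `|a n|%N = `|a m|%N %[mod p ^ m].
Proof.
move=> mn; have := padic_res_le a mn.
have [an am] : (0 <= a n)%R /\ (0 <= a m)%R by split; exact: padic_res_ge0.
case: (a n) an => // an _; case: (a m) am => // am _ /=.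
by rewrite modz_nat => -[->]; rewrite modn_mod.
Qed.

(** Compactness gives a cluster point. Modulo an open normal [N] of exponent [p^k] the powers are
    constant from [n = k] on, because the residues of [a] agree modulo [p^k]; so the cluster point
    is a limit. *)
Lemma padic_expg_cvg G (h : G) (a : padic p) : pro_p p G ->
  (h ^+ `|a n|%N) @[n --> \oo] --> padic_expg h a.
Proof.
move=> pG; have [[cG hG bG] _] := pG.
have [y [_ cly]] := cG ((fun n => h ^+ `|a n|%N) @ \oo) _ filterT.
suff ycvg : (h ^+ `|a n|%N) @[n --> \oo] --> y.
  rewrite /padic_expg; case: xgetP => [z _ zcvg|yN]; first exact: zcvg.
  by case: (yN y).
move=> V /nbhs_transl nV.
have [N [oN NV [k Nk]]] := pro_p_expn pG nV.
have [||_ [[n kn <-] /= Ny]] := cly [set h ^+ `|a n|%N | n in [set n | (k <= n)%N]]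
    [set z | subgroup_set N (y^-1 * z)].
- by exists k => // n kn; exists n.
- apply/nbhs_transl; have /subgroup_openP := oN; apply: filterS => z Nz.
  by rewrite /= mulKg.
exists k => // m km /=; rewrite -[_ ^+ _](mulVKg y); apply: NV.
rewrite -(mulVKg (h ^+ `|a n|%N) (h ^+ `|a m|%N)) mulgA; apply: subgroupM => //.
apply: expg_modn (Nk h) _.
by rewrite (padic_abs_mod a kn) (padic_abs_mod a km).
Qed.

Lemma padic_expg_closed G (h : G) (a : padic p) (C : set G) :
  pro_p p G -> closed C -> (\forall n \near \oo, C (h ^+ `|a n|%N)) ->
  C (padic_expg h a).
Proof.
by move=> pG cC nC; apply: (closed_cvg C cC nC); exact: padic_expg_cvg.
Qed.

(** The powers of [x] with exponent [p^m - 1] come arbitrarily close to [x^-1], since those with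
    exponent [p^m] come arbitrarily close to [1]. *)
Lemma closed_submonoidV G (C : set G) x : pro_p p G -> closed C ->
  C 1 -> (forall y z, C y -> C z -> C (y * z)) -> C x -> C x^-1.
Proof.
move=> pG cC C1 CM Cx; apply: cC => V /nbhs_transl nV.
have /(pro_pP p_pr)[_ /(_ _ x nV)[m /= Vm]] := pG.
exists (x^-1 * x ^+ (p ^ m)); split=> //.
have /prednK <- : (0 < p ^ m)%N by rewrite expn_gt0 prime_gt0.
rewrite expgS mulKg; elim: (_.-1) => [|n IH]; first by rewrite expg0.
by rewrite expgS; exact: CM.
Qed.

Lemma subgroup_valP (G : groupType) (H : subgroup G) (x : subgroup_type H) :
  subgroup_set H (val x).
Proof. by case: x => x Hx; exact: set_mem Hx. Qed.

Lemma subgroup_nbhsP G (H : subgroup G) (x : subgroup_type H)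
    (U : set (subgroup_type H)) :
  nbhs x U <-> exists2 V, nbhs (val x) V & val @^-1` V `<=` U.
Proof.
split=> [|[V nV VU]].
  rewrite nbhsE => -[B [[V oV <-] Vx] VU].
  by exists V => //; exact: open_nbhs_nbhs.
by apply: filterS VU _; exact: (@initial_continuous _ _ val).
Qed.

Lemma subgroup_closedP G (H : subgroup G) (C : set (subgroup_type H)) :
  closed C -> exists2 D, closed D & C = val @^-1` D.
Proof.
rewrite -openC => -[B oB BC]; exists (~` B); first exact: open_closedC.
by rewrite preimage_setC -[LHS]setCK; congr (~` _); exact/esym.
Qed.

Lemma pro_p_subgroup G (H : subgroup G) : closed H -> pro_p p G ->
  pro_p p (subgroup_type H).
Proof.
move=> cH /(pro_pP p_pr)[[cG hG bG] pG].
have cval : continuous (val : subgroup_type H -> G).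
  exact: initial_continuous.
apply/(pro_pP p_pr); split; first split.
- move=> F FF _.
  have cH' : compact H by apply: subclosed_compact cH cG _.
  have [|x [Hx clx]] := cH' (val @ F) _.
    by apply: (@filterS _ F _ setT) filterT => x _; exact: (subgroup_valP x).
  exists (exist _ x (mem_set Hx)); split=> // A B FA.
  move=> /subgroup_nbhsP[V nV VB].
  have [||_ [[a Aa <-] Va]] := clx (val @` A) V.
  + by apply: (@filterS _ F _ A) FA => a Aa; exists a.
  + exact: nV.
  by exists a; split=> //; exact: VB.
- move=> x y clxy; apply/val_inj/hG => A B nA nB.
  have [||z [Az Bz]] := clxy (val @^-1` A) (val @^-1` B).
  + exact: cval.
  + exact: cval.
  by exists (val z).
- move=> U /subgroup_nbhsP[V nV VU].
  have [K oK KV] := bG V nV.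
  have Ksub : is_subgroup [set x : subgroup_type H | subgroup_set K (val x)].
    split; first exact: subgroup1.
    by move=> x y /= Kx Ky; apply: (subgroupP K).2.
  exists (Subgroup Ksub); last by move=> x /= /KV /VU.
  by exists K.
- move=> U x /subgroup_nbhsP[V nV VU].
  have [m Vm] := pG V (val x) nV; exists m; apply: VU => /=.
  have vM : {morph (val : subgroup_type H -> G) : a b / a * b} by [].
  by rewrite (homX vM).
Qed.

Lemma coset_proj_surj G (N : normalSubgroup G) (x : quotient_group N) :
  exists y, coset_proj N y = x.
Proof. by exists (repr x); exact: reprK. Qed.

Lemma pro_p_quotient G (N : normalSubgroup G) : closed N -> pro_p p G ->
  pro_p p (quotient_group N).
Proof.
move=> cN pG; have /(pro_pP p_pr)[[cG hG bG] powG] := pG.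
have cpi := @coset_proj_continuous G N.
apply/(pro_pP p_pr); split; first split.
- have <- : @coset_proj G N @` setT = setT.
    by apply/seteqP; split=> // x _; have [y <-] := coset_proj_surj x; exists y.
  by apply: continuous_compact => //; exact: continuous_subspaceT.
- rewrite open_hausdorff => x y; have [a <-] := coset_proj_surj x.
  have [b <-] := coset_proj_surj y => /eqP ab.
  (* If [a N] and [b N] differ, then [a^-1 b] lies outside the closed [N], and so does [a^-1 b U]
     for some open normal [U]. The images of [a U] and [b U] are then disjoint: normality of [U]
     moves its elements past [a^-1 b]. *)
  have nN : nbhs (a^-1 * b) (~` N).
    apply: open_nbhs_nbhs; split; first exact: closed_openC.
    by move=> /eq_cosetP.
  have /nbhs_transl /(pro_p_expn pG)[U [oU UN _]] := nN.
  have otransl c : open (coset_proj N @` [set c * u | u in (U : set G)]).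
    apply: coset_proj_open.
    rewrite (_ : image _ _ = (fun z => c^-1 * z) @^-1` U).
      by apply: open_comp oU => z _; exact: continuous_mull.
    apply/seteqP; split=> [_ [u Uu <-] /=|z /= Uz]; first by rewrite mulKg.
    by exists (c^-1 * z) => //; rewrite mulVKg.
  exists (coset_proj N @` [set a * u | u in (U : set G)],
          coset_proj N @` [set b * u | u in (U : set G)]).
    by split; apply/mem_set; [exists a|exists b] => //; exists 1;
      rewrite ?mulg1 //; exact: subgroup1.
  split; [exact: otransl | exact: otransl|].
  apply/eqP/seteqP; split=> // z [] [_ [u Uu <-] <-].
  move=> [_ [v Uv <-]] /esym /eq_cosetP; rewrite invgM => Nz.
  apply: (UN ((u^-1) ^ (a^-1 * b) * v)).
    by apply: subgroupM => //; apply: Defs.normalP; exact: subgroupV.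
  by move: Nz; rewrite [in X in _ -> X]mulgA /conjg mulVKg !mulgA.
- move=> U nU; have [|H oH HU] := bG (coset_proj N @^-1` U).
    exact: (cpi 1 U nU).
  have Hsub : is_subgroup (coset_proj N @` H).
    split; first by exists 1 => //; exact: subgroup1.
    move=> _ _ [x Hx <-] [y Hy <-]; exists (x / y).
      exact: (subgroupP H).2.
    by rewrite quotient_group_mulE quotient_group_invE.
  exists (Subgroup Hsub); first exact: coset_proj_open.
  by move=> _ [x Hx <-]; exact: HU.
- move=> U x nU; have [y <-] := coset_proj_surj x.
  have [|m Um] := powG (coset_proj N @^-1` U) y; first exact: (cpi 1 U nU).
  by exists m; rewrite -(homX (@quotient_group_mulE G N)).
Qed.
End ProPConstructions.

(** * Characters of abelian pro-p groups *)

(** A copy of ['Z_q] written multiplicatively with the discrete topology, so that it can be a target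
    in the universal property. *)
Definition zmodg (q : nat) : Type := 'Z_q.

Section Zmodg.
Variable q : nat.
Import GRing.Theory.
Local Open Scope ring_scope.
Local Notation Z := (zmodg q).

HB.instance Definition _ := Choice.on Z.

Let addg (x y : Z) : Z := (x : 'Z_q) + (y : 'Z_q).
Let oppg (x : Z) : Z := - (x : 'Z_q).
Let addgA : associative addg. Proof. by move=> x y z; exact: addrA. Qed.
Let add0g : left_id (0 : 'Z_q) addg. Proof. by move=> x; exact: add0r. Qed.
Let addg0 : right_id (0 : 'Z_q) addg. Proof. by move=> x; exact: addr0. Qed.
Let addNg : left_inverse (0 : 'Z_q) oppg addg.
Proof. by move=> x; exact: addNr. Qed.
Let addgN : right_inverse (0 : 'Z_q) oppg addg.
Proof. by move=> x; exact: subrr. Qed.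

HB.instance Definition _ := isGroup.Build Z addgA add0g addg0 addNg addgN.
HB.instance Definition _ := Topological.copy Z (discrete_topology 'Z_q).

Let mul_continuous : continuous (fun xy : Z * Z => (xy.1 * xy.2)%g).
Proof.
move=> [x y] U /principal_filterP Uxy; exists ([set x], [set y]) => /=.
  by split; exact/principal_filterP.
by move=> [_ _] /= [-> ->].
Qed.

Let inv_continuous : continuous (fun x : Z => x^-1%g).
Proof. by move=> x U /principal_filterP Ux; exact/principal_filterP. Qed.

HB.instance Definition _ :=
  isTopologicalGroup.Build Z mul_continuous inv_continuous.

Lemma zmodg_expE (x : Z) n : (x ^+ n)%g = (x : 'Z_q) *+ n.
Proof. by elim: n => [|n IH] //; rewrite expgS mulrS IH. Qed.

Lemma zmodg_pro_p (p k : nat) (p_pr : prime p) :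
  (0 < k)%N -> q = (p ^ k)%N -> pro_p p Z.
Proof.
move=> k0 qE; have q1 : (1 < q)%N by rewrite qE -(exp1n k) ltn_exp2r ?prime_gt1.
apply/(pro_pP p_pr); split; first split.
- by apply: finite_compact; exact: (@finite_finset 'Z_q).
- exact: (@discrete_hausdorff (discrete_topology 'Z_q)).
- move=> U /principal_filterP U1.
  have tr1 : is_subgroup [set (1 : Z)%g].
    by split=> // x y /= -> ->; rewrite mulgV.
  exists (Subgroup tr1); last by move=> x /= ->.
  exact: (@discrete_open (discrete_topology 'Z_q)).
- move=> U x /principal_filterP U1; exists k.
  by rewrite zmodg_expE -qE -mulr_natr (pchar_Zp q1) mulr0.
Qed.

Lemma zmodg_abelian : abelian_group Z.
Proof. by move=> x y; exact: addrC. Qed.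
End Zmodg.

Definition character (q : nat) (A : topGroupType) (f : A -> 'Z_q) : Prop :=
  continuous (f : A -> discrete_topology 'Z_q) /\
  forall x y, f (x * y)%g = (f x + f y)%R.

Section AbelianProP.
Variables (p : nat) (p_pr : prime p).
Local Open Scope group_scope.

Let expn_gt1 n : (0 < n)%N -> (1 < p ^ n)%N.
Proof. by move=> n0; rewrite -(exp1n n) ltn_exp2r // prime_gt1. Qed.

Lemma character1 q (A : topGroupType) (f : A -> 'Z_q) : character f -> f 1 = 0%R.
Proof. by move=> [_ fM]; apply: (GRing.addrI (f 1)); rewrite -fM mulg1 GRing.addr0. Qed.

Lemma characterX q (A : topGroupType) (f : A -> 'Z_q) x n :
  character f -> f (x ^+ n) = (f x *+ n)%R.
Proof.
move=> cf; elim: n => [|n IH]; first exact: character1.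
by rewrite expgS cf.2 IH GRing.mulrS.
Qed.

Lemma character_ker q (A : topGroupType) (f : A -> 'Z_q) : character f ->
  exists H : subgroup A, [/\ open H, closed H & H = [set x | f x = 0%R] :> set A].
Proof.
move=> cf; have kf : is_subgroup [set x | f x = 0%R].
  split; first exact: character1.
  move=> x y /= fx fy; have : f (x / y * y) = 0%R by rewrite mulgVK.
  by rewrite cf.2 fy GRing.addr0.
exists (Subgroup kf); split=> //.
  by have /continuousP/(_ [set 0%R]) := cf.1; apply; exact: discrete_open.
have /continuous_closedP/(_ [set 0%R]) := cf.1; apply; exact: discrete_closed.
Qed.

Lemma twist_proj_fun_nat n k : (0 < n)%N ->
  twist_proj_fun (k%:R : 'Z_(p ^ n))%R = (k%:R : 'Z_(p ^ 1))%R.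
Proof.
move=> n0; rewrite /twist_proj_fun val_Zp_nat ?expn_gt1 //.
have gt1 := expn_gt1 (ltn0Sn 0).
rewrite -(Zp_nat_mod gt1) -[in RHS](Zp_nat_mod gt1).
by rewrite modn_dvdm // dvdn_exp2l.
Qed.

Lemma twist_proj_funD n (x y : 'Z_(p ^ n)) : (0 < n)%N ->
  twist_proj_fun (x + y)%R = (twist_proj_fun x + twist_proj_fun y)%R.
Proof.
move=> n0; rewrite -[x]natr_Zp -[y]natr_Zp -GRing.natrD.
by rewrite !twist_proj_fun_nat // GRing.natrD.
Qed.

(** The values of [f] on the basis are lifted arbitrarily and extended by the universal property to
    [g]. The reduction of [g] agrees with [f] on the basis, hence everywhere by uniqueness. *)
Lemma free_abelian_lift (A : topGroupType) (f : A -> 'Z_(p ^ 1)) n :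
  (0 < n)%N -> free_abelian_pro_p p A -> character f ->
  exists2 g : A -> 'Z_(p ^ n), character g &
    forall x, twist_proj_fun (g x) = f x.
Proof.
move=> n0 [pA abA [X [i [i1 univ]]]] cf.
(* The lift by least representatives sends zero to zero, which keeps [j] convergent to [1]. *)
pose j x : zmodg (p ^ n) := ((f (i x) : nat)%:R)%R.
have fi1 : converges_to_1 (f \o i : X -> zmodg (p ^ 1)).
  move=> U /principal_filterP U1.
  have : nbhs (1 : A) (f @^-1` [set 0%R]).
    have [H [oH _ HE]] := character_ker cf.
    by have /subgroup_openP := oH; rewrite HE.
  move=> /i1 fin; apply: (sub_finite_set _ fin) => x /= NU fix0; apply: NU.
  by rewrite fix0.
have j1 : converges_to_1 j.
  move=> U /principal_filterP U1.
  have fin : finite_set [set x | ~ [set (1 : zmodg (p ^ 1))] ((f \o i) x)].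
    by apply: fi1; exact/principal_filterP.
  apply: (sub_finite_set _ fin) => x /= NU fix0; apply: NU.
  by rewrite /j /= fix0.
have [g [[cg gM gi] _]] :=
  univ (zmodg (p ^ n)) (zmodg_pro_p p_pr n0 erefl) (@zmodg_abelian _) j j1.
exists g; first by split.
pose g' (x : A) : zmodg (p ^ 1) := twist_proj_fun (g x).
have [f' [_ f'u]] := univ (zmodg (p ^ 1)) (zmodg_pro_p p_pr (ltn0Sn 0) erefl)
  (@zmodg_abelian _) (f \o i) fi1.
suff e : g' = f by move=> x; rewrite -[in RHS]e.
rewrite -(f'u f) ?(f'u g') //.
- split.
  + move=> x U /principal_filterP Ug.
    have ng : nbhs x (g @^-1` [set g x]) by apply: cg; exact/principal_filterP.
    by apply: filterS ng => y /= yx; rewrite /g' yx.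
  + by move=> x y; rewrite /g' gM twist_proj_funD.
  + apply/funext => x /=; rewrite /g' -[g (i x)]/((g \o i) x) gi /j.
    by rewrite twist_proj_fun_nat // natr_Zp.
- by split=> //; [exact: cf.1 | move=> x y; exact: cf.2].
Qed.
End AbelianProP.

(** * Characters dual to an irredundant generating family *)

Section LiftingFree.
Import GRing.Theory.
Variables (p : nat) (p_pr : prime p).
Local Open Scope group_scope.

(** An open normal [U] with [x U] disjoint from [H] reduces the claim to the finite p-group of
    cosets of [U], in which the image of [H] misses that of [x]. *)
Lemma character_closed_subgroup (A : topGroupType) (H : subgroup A) x :
  pro_p p A -> closed H -> ~ subgroup_set H x ->
  exists f : A -> 'Z_(p ^ 1), [/\ character f,
    forall y, subgroup_set H y -> f y = 0%R & exists y, f y <> 0%R].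
Proof.
move=> pA cH Hx; have nHx : nbhs x (~` H).
  by apply: open_nbhs_nbhs; split=> //; exact: closed_openC.
have /nbhs_transl /(pro_p_expn pA)[U [oU UH _]] := nHx.
have cardU := pA.2 U oU.
have piM := @quotient_group_mulE A U.
have piH : is_subgroup (coset_proj U @` H).
  split; first by exists 1 => //; exact: subgroup1.
  move=> _ _ [y Hy <-] [z Hz <-]; exists (y / z); first exact: (subgroupP H).2.
  by rewrite quotient_group_mulE quotient_group_invE.
have [|f [fM fH [y fy]]] :=
    @p_group_charP p p_pr _ (Subgroup piH) (coset_proj U x) cardU.
  move=> [y Hy /esym /eq_cosetP /UH]; rewrite /= mulVKg; exact.
have [z zy] := coset_proj_surj y.
exists (f \o coset_proj U); split.
- split; last by move=> u v /=; rewrite piM fM.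
  apply/locally_constantP => u.
  have : nbhs u [set v | subgroup_set U (u^-1 * v)].
    apply/nbhs_transl; have /subgroup_openP := oU; apply: filterS => v Uv /=.
    by rewrite mulKg.
  by apply: filterS => v /eq_cosetP /= <-.
- by move=> u Hu; apply: fH; exists u.
- by exists z; rewrite /= zy; exact/eqP.
Qed.

Lemma hausdorff_nbhs1 (A : topGroupType) (x : A) : hausdorff_space A ->
  (forall U : set A, nbhs 1 U -> U x) -> x = 1.
Proof.
move=> hA Ux; apply/esym/hA => U V nU nV.
by exists x; split; [exact: Ux | exact: nbhs_singleton].
Qed.

Lemma eq_on_closed_gen (A B : topGroupType) (S : set A) (f g : A -> B) :
  hausdorff_space B -> continuous f -> continuous g ->
  {morph f : x y / x * y} -> {morph g : x y / x * y} ->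
  (forall x, S x -> f x = g x) -> forall x, subgroup_set (closed_gen S) x -> f x = g x.
Proof.
move=> hB cf cg fM gM fg.
have kfg : is_subgroup [set x | f x = g x].
  split; first by rewrite /= !hom1.
  by move=> x y /= fgx fgy; rewrite fM gM (homV fM) (homV gM) fgx fgy.
apply: (@closed_gen_min A S (Subgroup kfg)) => //=.
have -> : [set x | f x = g x] = (fun x => (f x)^-1 * g x) @^-1` [set 1].
  apply/seteqP; split=> x /= => [->|e]; first by rewrite mulVg.
  by rewrite -[RHS](mulVKg (f x)) e mulg1.
apply: closed_preimage.
  by apply: continuous_mulg => //; exact: continuous_invg.
by apply: compact_closed => //; exact: compact_set1.
Qed.

(** In a generating family of least size, the generators other than [h i] generate a proper closed
    subgroup. A nonzero character that kills this subgroup cannot vanish on [h i]. *)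
Lemma independent_generators (A : topGroupType) : pro_p p A ->
  topologically_fg A ->
  exists d (h : 'I_d -> A), closed_gen (range h) = setT :> set A /\
    forall i, exists f : A -> 'Z_(p ^ 1), [/\ character f,
      forall j, j != i -> f (h j) = 0%R & f (h i) <> 0%R].
Proof.
move=> pA [S /finite_seqP[s ->] sA].
pose P n := `[< exists s : seq A, size s = n /\ closed_gen [set` s] = setT :> set A >].
have exP : exists n, P n by exists (size s); apply/asboolP; exists s.
case: (ex_minnP exP) => d /asboolP[{sA}s {exP} [sd sA]] dmin.
pose h (i : 'I_d) := nth 1 s i.
have hs : range h = [set` s].
  apply/seteqP; split=> [_ [i _ <-]|x xs] /=; first by rewrite mem_nth ?sd.
  have xd : (index x s < d)%N by rewrite -sd index_mem.
  by exists (Ordinal xd) => //; rewrite /h /= nth_index.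
exists d, h; split=> [|i]; first by rewrite hs.
pose s' := take i s ++ drop i.+1 s.
have ss' : (size s').+1 = d.
  rewrite size_cat size_take size_drop sd ltn_ord.
  by have := ltn_ord i; lia.
have [x Hx] : exists x, ~ subgroup_set (closed_gen [set` s']) x.
  apply: contrapT => /forallNP Hs'.
  suff /dmin : P (size s') by rewrite -ss' ltnn.
  apply/asboolP; exists s'; split=> //; apply/seteqP; split=> // x _.
  by apply: contrapT => /Hs'.
have [f [cf f0 [y fy]]] := character_closed_subgroup pA (@closed_gen_closed _ _) Hx.
have fj j : j != i -> f (h j) = 0%R.
  move=> ji; apply: f0; apply: closed_gen_sub.
  have : j != i :> nat by [].
  rewrite /= mem_cat /h; case: ltngtP => // [ji' _|ij _]; apply/orP.
    left; rewrite -[nth _ _ _](nth_take 1 ji') mem_nth // size_take sd.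
    by rewrite ltn_ord.
  right; have -> : nth 1 s j = nth 1 (drop i.+1 s) (j - i.+1).
    by rewrite nth_drop subnKC.
  by rewrite mem_nth // size_drop sd ltn_sub2r // (leq_ltn_trans ij).
exists f; split=> // fi; apply: fy.
have [H [_ cH HE]] := character_ker cf.
have : subgroup_set (closed_gen (range h)) y by rewrite hs sA.
move=> /(closed_gen_min cH); rewrite HE; apply=> _ [j _ <-] /=.
by have [->|/fj] := eqVneq j i.
Qed.

(** Modulo [p] the matrix [c] is diagonal with nonzero diagonal. Once all [k j] are divisible by
    [p^l], dividing the [i]-th equation by [p^l] and reading it modulo [p] gives one more factor [p]
    in [k i]. *)
Lemma dvdz_diag_system d n (c : 'I_d -> 'I_d -> int) (k : 'I_d -> int) :
  (forall i j, j != i -> (p %| c i j)%Z) -> (forall i, ~~ (p %| c i i)%Z) ->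
  (forall i, ((p ^ n)%N %| (\sum_j c i j * k j)%R)%Z) ->
  forall i, ((p ^ n)%N %| k i)%Z.
Proof.
move=> cij cii ck.
suff kl l : (l <= n)%N -> forall i, ((p ^ l)%N %| k i)%Z by exact: kl.
elim: l => [|l IH] ln i; first by rewrite expn0 dvd1z.
have pl0 : ((p ^ l)%N : int) != 0%R by rewrite eqz_nat -lt0n expn_gt0 prime_gt0.
have kE j : k j = ((k j %/ (p ^ l)%N)%Z * (p ^ l)%N)%R.
  by rewrite divzK // IH // ltnW.
rewrite kE expnS PoszM dvdz_mul2r //.
have : ((p * p ^ l)%N %| (\sum_j c i j * k j)%R)%Z.
  by apply: dvdz_trans (ck i); rewrite dvdzE /= -expnS dvdn_exp2l.
under eq_bigr => j _ do rewrite kE mulrA.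
rewrite -mulr_suml PoszM dvdz_mul2r // (bigD1 i) //=.
rewrite rpredDr; last by apply: rpred_sum => j ji; rewrite dvdz_mulr // cij.
by rewrite Gauss_dvdzr // coprimezE prime_coprime // -dvdzE.
Qed.

Lemma Zp_nat_eq0 q n : (1 < q)%N -> ((n%:R : 'Z_q) == 0)%R = (q %| n).
Proof. by move=> q1; rewrite -val_eqE /= val_Zp_nat. Qed.

Lemma Zp_int_eq0 q (a : int) : (1 < q)%N -> ((a%:~R : 'Z_q) == 0)%R = (q %| a)%Z.
Proof.
move=> q1; rewrite dvdzE /=; case: a => n; first exact: Zp_nat_eq0.
by rewrite NegzE mulrNz oppr_eq0 abszN; exact: Zp_nat_eq0.
Qed.

Section Combinations.
Variables (d : nat) (A : groupType) (h : 'I_d -> A).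

Definition combination (m : 'I_d -> nat) : A := \big[*%g/1]_(i < d) (h i ^+ m i).

Lemma combinationD m m' : abelian_group A ->
  combination (fun i => m i + m' i)%N = combination m * combination m'.
Proof.
move=> abA; rewrite -prodgM_commute; last by move=> i j _ _; exact: abA.
by apply: eq_bigr => i _; rewrite expgnDr.
Qed.

Lemma combination0 : combination (fun=> 0%N) = 1.
Proof. by rewrite /combination big1 // => i _. Qed.

Lemma combination1 i : combination (fun j => (j == i) : nat) = h i.
Proof.
rewrite /combination (big_only1 i) ?eqxx // => j /negbTE -> _.
by rewrite expg0.
Qed.
End Combinations.

Lemma character_combination q d (A : topGroupType) (h : 'I_d -> A)
    (f : A -> 'Z_q) m : character f ->
  f (combination h m) = (\sum_i f (h i) *+ m i)%R.
Proof.
move=> cf; rewrite (big_morph f cf.2 (character1 cf)).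
by apply: eq_bigr => i _; rewrite characterX.
Qed.

Lemma hom_combination d (A B : groupType) (h : 'I_d -> A) (f : A -> B) m :
  {morph f : x y / x * y} -> f (combination h m) = combination (f \o h) m.
Proof.
move=> fM; rewrite (big_morph f fM (hom1 fM)).
by apply: eq_bigr => i _; rewrite (homX fM).
Qed.

Lemma character_combinationB q d (A : topGroupType) (h : 'I_d -> A)
    (f : A -> 'Z_q) m m' : character f ->
  (f (combination h m) - f (combination h m') =
   (\sum_i Posz (f (h i)) * (Posz (m i) - Posz (m' i)))%:~R)%R.
Proof.
move=> cf; rewrite !character_combination // -sumrB.
rewrite (big_morph _ (intrD 'Z_q) (erefl : (0 : int)%:~R = 0 :> 'Z_q)%R).
apply: eq_bigr => i _.
rewrite intrM intrB -!pmulrn natr_Zp mulrBr.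
by rewrite !mulr_natr.
Qed.

(** The differences [m j - m' j] solve a linear system modulo [p^n] whose matrix, the values
    [f i (h j)], is diagonal and invertible modulo [p]. *)
Lemma combination_congr d n (A : topGroupType) (h : 'I_d -> A)
    (f : 'I_d -> A -> 'Z_(p ^ n)) m m' : (0 < n)%N ->
  (forall i, character (f i)) ->
  (forall i j, j != i -> twist_proj_fun (f i (h j)) = 0%R) ->
  (forall i, twist_proj_fun (f i (h i)) <> 0%R) ->
  (forall i, f i (combination h m) = f i (combination h m')) ->
  forall i, m i = m' i %[mod p ^ n].
Proof.
move=> n0 cf fij fii fm i.
have q1 : (1 < p ^ n)%N by rewrite -(exp1n n) ltn_exp2r ?prime_gt1.
have p1 : (1 < p ^ 1)%N by rewrite expn1 prime_gt1.
have projE (x : 'Z_(p ^ n)) : (twist_proj_fun x == 0)%R = (p %| (x : nat))%N.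
  by rewrite /twist_proj_fun Zp_nat_eq0 // expn1.
pose c i j : int := (f i (h j) : nat).
have ck : forall i, ((p ^ n)%N %| (\sum_j c i j * (Posz (m j) - Posz (m' j)))%R)%Z.
  move=> j; rewrite -Zp_int_eq0 //.
  by rewrite -character_combinationB // fm subrr.
have := @dvdz_diag_system d n c (fun j => (Posz (m j) - Posz (m' j))%R) _ _ ck i.
have cij j l : l != j -> (p %| c j l)%Z.
  by move=> /fij /eqP; rewrite projE dvdzE.
have cii j : ~~ (p %| c j j)%Z by have /eqP := fii j; rewrite projE dvdzE.
move=> /(_ cij cii); rewrite -eqz_mod_dvd => /eqP.
by rewrite !modz_nat => -[].
Qed.

Lemma combination_quotient d (B : groupType) (N : normalSubgroup B)
    (f : 'I_d -> B) q m m' :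
  (forall x, subgroup_set N (x ^+ q)) -> (forall i, m i = m' i %[mod q]) ->
  subgroup_set N ((combination f m)^-1 * combination f m').
Proof.
move=> Nq mm'; apply/eq_cosetP; rewrite !(hom_combination _ _ (@quotient_group_mulE B N)).
apply: eq_bigr => i _ /=; rewrite -!(homX (@quotient_group_mulE B N)).
by apply/eq_cosetP; exact: expg_modn (Nq _) (mm' i).
Qed.
End LiftingFree.

(** * Freeness from lifts of characters *)

Section LiftingFree.
Variables (p : nat) (p_pr : prime p).
Local Open Scope group_scope.

Section Graph.
Variables (A B : topGroupType) (pA : pro_p p A) (pB : pro_p p B).
Hypotheses (abA : abelian_group A) (abB : abelian_group B).
Variables (d : nat) (h : 'I_d -> A) (f : 'I_d -> B).
Hypothesis hA : closed_gen (range h) = setT :> set A.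

(** Closure of the graph of the homomorphism to be built. Natural exponents are enough, because a
    closed submonoid of a pro-p group is a subgroup. *)
Let E : set (A * B) :=
  closure [set ab | exists m, ab = (combination h m, combination f m)].

Let E_combination m : E (combination h m, combination f m).
Proof. by apply: subset_closure; exists m. Qed.

Let cE : closed E. Proof. exact: closed_closure. Qed.

Let E_min (C : set (A * B)) : closed C ->
  (forall m, C (combination h m, combination f m)) -> E `<=` C.
Proof.
move=> cC Cm; rewrite (iffLR (closure_id C)) //; apply: closureS => _ [m ->].
exact: Cm.
Qed.

Let mulr_prod_continuous (a : A) (b : B) :
  continuous (fun xy : A * B => (xy.1 * a, xy.2 * b)).
Proof.
move=> [x y]; apply: cvg_pair.
  apply: (@continuous_mulg _ _ fst (fun=> a)); last exact: cst_continuous.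
  by move=> z; exact: cvg_fst.
apply: (@continuous_mulg _ _ snd (fun=> b)); last exact: cst_continuous.
by move=> z; exact: cvg_snd.
Qed.

Let mull_prod_continuous (a : A) (b : B) :
  continuous (fun xy : A * B => (a * xy.1, b * xy.2)).
Proof.
move=> [x y]; apply: cvg_pair.
  apply: (@continuous_mulg _ _ (fun=> a) fst); first exact: cst_continuous.
  by move=> z; exact: cvg_fst.
apply: (@continuous_mulg _ _ (fun=> b) snd); first exact: cst_continuous.
by move=> z; exact: cvg_snd.
Qed.

(** The closure is taken in one factor at a time: first against a combination on the right, then
    against an arbitrary point of [E] on the left. *)
Let E_mul a b a' b' : E (a, b) -> E (a', b') -> E (a * a', b * b').
Proof.
have step m x y : E (x, y) -> E (x * combination h m, y * combination f m).
  move: x y; suff sE : E `<=` (fun xy => (xy.1 * combination h m,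
      xy.2 * combination f m)) @^-1` E by move=> x y /sE.
  apply: E_min; first exact: closed_preimage.
  by move=> m' /=; rewrite -!combinationD.
move=> Eab; suff sE : E `<=` (fun xy => (a * xy.1, b * xy.2)) @^-1` E.
  by move/sE.
apply: E_min; first exact: closed_preimage.
by move=> m /=; exact: step.
Qed.

(** The projection of the compact set [E] to [A] is closed and is a submonoid containing the
    generators, hence is all of [A]. *)
Let E_total a : exists b, E (a, b).
Proof.
have [cA hausA _] := pA.1; have [cB hausB _] := pB.1.
pose C : set A := fst @` E.
have cC : closed C.
  apply: compact_closed => //; apply: continuous_compact.
    by apply: continuous_subspaceT => x; exact: cvg_fst.
  apply: subclosed_compact cE (compact_setX cA cB) _.
  by move=> [x y] _.
have CM x y : C x -> C y -> C (x * y).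
  move=> [[x' b] Exb /= <-] [[y' b'] Eyb /= <-]; exists (x' * y', b * b') => //.
  exact: E_mul.
have C1 : C 1.
  exists (combination h (fun=> 0%N), combination f (fun=> 0%N)) => //=.
  by rewrite combination0.
have C_sub : is_subgroup C.
  split=> // x y Cx Cy; apply: (CM) => //.
  exact: (closed_submonoidV p_pr pA cC C1 CM Cy).
have hC : range h `<=` C.
  move=> _ [i _ <-]; exists (combination h (fun j => (j == i) : nat),
    combination f (fun j => (j == i) : nat)) => //=.
  by rewrite combination1.
have : subgroup_set (closed_gen (range h)) a by rewrite hA.
move=> /(@closed_gen_min _ _ (Subgroup C_sub) cC hC) [[x b] Exb /= <-].
by exists b.
Qed.

(** Stands in for a dual basis: the matrix of values is diagonal and invertible only modulo [p],
    which suffices to control exponents modulo [p^n]. *)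
Hypothesis dual : forall n, (0 < n)%N ->
  exists g : 'I_d -> A -> 'Z_(p ^ n), [/\ forall i, character (g i),
    forall i j, j != i -> twist_proj_fun (g i (h j)) = 0%R &
    forall i, twist_proj_fun (g i (h i)) <> 0%R].

(** Uniform continuity of the relation [E]. Points of [E] are approximated by combinations; if the
    dual characters modulo [p^(k+1)] agree on the [A] sides, the exponents are congruent modulo
    [p^(k+1)], so the [B] sides agree modulo [N]. *)
Let E_uniform (U : set B) : nbhs 1 U ->
  exists2 W : set A, nbhs 1 W &
    forall a b a' b', E (a, b) -> E (a', b') -> W (a^-1 * a') -> U (b^-1 * b').
Proof.
move=> /(pro_p_expn pB)[N [oN NU [k Nk]]].
(* The exponent [k] may be zero, while [dual] requires a positive level, hence [k.+1]. *)
have Nk1 x : subgroup_set N (x ^+ (p ^ k.+1)).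
  by rewrite expnSr expgnA; exact: subgroupX.
have [g [cg gij gii]] := dual (ltn0Sn k).
pose W := [set a | forall i, g i a = 0%R].
have nW : nbhs 1 W.
  apply: filter_forall => i; have [H [oH _ HE]] := character_ker (cg i).
  by have /subgroup_openP := oH; rewrite HE.
exists W => // a b a' b' Eab Eab' Waa'.
have approx x y : E (x, y) -> exists2 m, W (x^-1 * combination h m) &
    subgroup_set N (y^-1 * combination f m).
  move=> Exy.
  have [_ [[m ->] [/= Wm Nm]]] : [set ab | exists m, ab = (combination h m,
      combination f m)] `&` ([set z | W (x^-1 * z)] `*`
      [set z | subgroup_set N (y^-1 * z)]) !=set0.
    apply: Exy; exists ([set z | W (x^-1 * z)],
      [set z | subgroup_set N (y^-1 * z)]) => //=; split.
      by apply/nbhs_transl; apply: filterS nW => z; rewrite /= mulKg.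
    apply/nbhs_transl; have /subgroup_openP := oN; apply: filterS => z.
    by rewrite /= mulKg.
  by exists m.
have gW i x y : W (x^-1 * y) -> g i x = g i y.
  move=> Wxy; have -> : y = x * (x^-1 * y) by rewrite mulVKg.
  by rewrite (cg i).2 Wxy GRing.addr0.
have [m Wm Nm] := approx a b Eab; have [m' Wm' Nm'] := approx a' b' Eab'.
have mm' i : m i = m' i %[mod p ^ k.+1].
  apply: (combination_congr p_pr (ltn0Sn k) cg gij gii) => j.
  by rewrite -(gW j _ _ Wm) -(gW j _ _ Wm'); exact: gW.
have := combination_quotient f Nk1 mm'; set c := combination f m.
set c' := combination f m' => Ncc'; apply: NU.
have -> : b^-1 * b' = (b^-1 * c) * ((c^-1 * c') * (b'^-1 * c')^-1).
  by rewrite invgM invgK -!mulgA !mulVKg.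
by apply: subgroupM => //; apply: subgroupM => //; exact: subgroupV.
Qed.

Lemma extension_of_dual : exists F : A -> B,
  [/\ continuous F, {morph F : x y / x * y} & F \o h = f].
Proof.
have [_ hausB _] := pB.1.
(* Single-valuedness is the case [a = a'] of uniform continuity, in a Hausdorff target. *)
have E_fun a b b' : E (a, b) -> E (a, b') -> b = b'.
  move=> Eb Eb'; apply: (mulgI b^-1); rewrite mulVg; apply/esym.
  apply: hausdorff_nbhs1 => // U /E_uniform[W nW WU].
  by apply: WU Eb Eb' _; rewrite mulVg; exact: nbhs_singleton nW.
pose F a := sval (cid (E_total a)).
have EF a : E (a, F a) by rewrite /F; case: cid.
exists F; split.
- move=> a V /nbhs_transl /E_uniform[W nW WV].
  have : nbhs a [set x | W (a^-1 * x)].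
    by apply/nbhs_transl; apply: filterS nW => x; rewrite /= mulKg.
  by apply: filterS => x Wx; rewrite /= -(mulVKg (F a) (F x)); exact: WV Wx.
- by move=> x y; apply: (E_fun (x * y)) => //; exact: E_mul.
- apply/funext => i /=; apply: (E_fun (h i)) => //.
  by rewrite -(combination1 h i) -(combination1 f i).
Qed.
End Graph.

(** The lifts of the characters dual to an irredundant generating family satisfy [dual] at every
    level. That family is then the free basis; being finite, it converges to [1]. *)
Lemma free_abelian_of_lifts (A : topGroupType) :
  pro_p p A -> abelian_group A -> topologically_fg A ->
  (forall (f : A -> 'Z_(p ^ 1)) n, (0 < n)%N -> character f ->
    exists2 g : A -> 'Z_(p ^ n), character g &
      forall x, twist_proj_fun (g x) = f x) ->
  free_abelian_pro_p p A.
Proof.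
move=> pA abA fgA lift; split=> //.
have [d [h [hA ind]]] := independent_generators p_pr pA fgA.
have dual n : (0 < n)%N ->
  exists g : 'I_d -> A -> 'Z_(p ^ n), [/\ forall i, character (g i),
    forall i j, j != i -> twist_proj_fun (g i (h j)) = 0%R &
    forall i, twist_proj_fun (g i (h i)) <> 0%R].
  move=> n0; have /choice[g gP] i : exists g : A -> 'Z_(p ^ n), [/\ character g,
      forall j, j != i -> twist_proj_fun (g (h j)) = 0%R &
      twist_proj_fun (g (h i)) <> 0%R].
    have [f [cf fj fi]] := ind i.
    have [g cg gf] := lift f n n0 cf.
    by exists g; split=> // [j /fj|]; rewrite gf.
  by exists g; split=> i; have [] := gP i.
exists 'I_d, h; split=> [U _|B pB abB f _]; first exact: finite_finset.
have [F [cF FM Fh]] := extension_of_dual pA pB abA abB f hA dual.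
exists F; split=> // F' [cF' FM' Fh'].
have [_ hausB _] := pB.1.
apply/funext => x; apply: (@eq_on_closed_gen _ _ (range h)) => //.
  by move=> _ [i _ <-]; have := congr1 (@^~ i) Fh'; rewrite -Fh.
by rewrite hA.
Qed.
End LiftingFree.

(** * The image of theta *)

Section PowerClosure.
Variables (p : nat) (p_pr : prime p).
Local Open Scope group_scope.

Lemma closure_submonoid (G : topGroupType) (D : set G) :
  (forall x y, D x -> D y -> D (x * y)) ->
  forall x y, closure D x -> closure D y -> closure D (x * y).
Proof.
move=> DM.
have cmin (C : set G) : closed C -> D `<=` C -> closure D `<=` C.
  by move=> cC DC; rewrite (iffLR (closure_id C)) //; exact: closureS.
have step x y : closure D x -> D y -> closure D (x * y).
  move=> + Dy; move: x; apply: cmin => [|x Dx].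
    by apply: (closed_preimage (@continuous_mulr G y)); exact: closed_closure.
  by apply: subset_closure; exact: DM.
move=> x y Dx; move: y; apply: cmin => [|y Dy]; last exact: step.
by apply: (closed_preimage (@continuous_mull G x)); exact: closed_closure.
Qed.

(** The closure of the natural powers is a closed submonoid, hence already a subgroup. *)
Lemma closed_gen1_closure (G : topGroupType) (t : G) : pro_p p G ->
  closed_gen [set t] `<=` closure [set t ^+ j | j in [set: nat]].
Proof.
move=> pG; set D := [set _ | _ in _]; have cD := @closed_closure _ D.
have DM x y : D x -> D y -> D (x * y).
  by move=> [i _ <-] [j _ <-]; exists (i + j)%N => //; rewrite expgnDr.
have clM := closure_submonoid DM.
have cl1 : closure D 1 by apply: subset_closure; exists 0%N.
have clD : is_subgroup (closure D).
  split=> // x y Dx Dy; apply: (clM) => //.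
  exact: (closed_submonoidV p_pr pG cD cl1 clM Dy).
apply: (@closed_gen_min _ _ (Subgroup clD)) => // x ->.
by apply: subset_closure; exists 1%N => //; rewrite expg1.
Qed.
End PowerClosure.

Section Theta.
Variables (p : nat) (p_pr : prime p) (P : cyclotomicPair p).
Import GRing.Theory.
Local Open Scope group_scope.
Implicit Types g h s t : P.

Let pP : pro_p p P. Proof. exact: cyc_pro_p. Qed.

Lemma thetaVl g : (theta (g^-1)%g * theta g = 1)%R.
Proof. by rewrite -thetaM mulVg theta1. Qed.

Lemma thetaX g n : theta (g ^+ n) = (theta g ^+ n)%R.
Proof.
by elim: n => [|n IH]; rewrite ?expg0 ?theta1 // expgS thetaM IH exprS.
Qed.

Lemma theta_div g h : theta g = theta h <-> theta (g / h) = 1%R.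
Proof.
rewrite thetaM; split=> [->|e]; first by rewrite mulrC thetaVl.
by rewrite -[LHS]mulr1 -(thetaVl h) mulrA e mul1r.
Qed.

Lemma theta_res_open n g : nbhs g [set h | theta h n = theta g n].
Proof.
have : nbhs (theta g) [set y : padic p | y n = theta g n] by exists n.
by move=> /(@theta_continuous _ P g).
Qed.

Lemma theta_res_closed n a : closed [set g : P | theta g n = a].
Proof.
move=> g clg; have [h [/= <- ->]] := clg _ (theta_res_open n g).
by [].
Qed.

Lemma theta_ker_closed : closed (theta_ker P).
Proof.
rewrite (_ : (theta_ker P : set P) =
  \bigcap_(n in [set: nat]) [set g : P | theta g n = (1%R : padic p) n]).
  by apply: closed_bigI => n _; exact: theta_res_closed.
apply/seteqP; split=> g /=; first by move=> g1 n _ /=; rewrite g1.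
by move=> gP; apply: padic_inj => n; exact: gP n I.
Qed.

Lemma theta_res1 g : theta g 1%N = (1%R : padic p) 1%N.
Proof.
have [z ->] := theta_one_units g; apply/padic_res_eqP => //.
by exists z; rewrite addrC addKr expn1.
Qed.

(** Passing to [p]-th powers moves the image of [theta] into [1 + p^2 Z_p], where lifting the
    exponent also works for [p = 2]. *)
Lemma thetaXp_res2 g : (theta g ^+ p)%R 2 = (1%R : padic p) 2.
Proof.
have [z ->] := theta_one_units g; apply/padic_res_eqP => //.
have [y ->] := expr1D (p%:R * z)%R p.
exists (z + z ^+ 2 * y)%R; rewrite natrX; ring.
Qed.

(** Take [t] with [theta t ^+ p] as far from [1] as possible, say [1 + p^k u] with [u] a unit. Its
    powers approximate every [theta g ^+ p], and torsion freeness removes the [p]-th power. If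
    [theta s = 1] for a limit [s] of powers of [t], the exponents tend to [0] p-adically, so
    [s = 1]. *)
Lemma procyclic_section (P_tf : torsion_free_pair P) : exists t,
  (forall g, exists2 s, subgroup_set (closed_gen [set t]) s & theta s = theta g) /\
  (forall s, subgroup_set (closed_gen [set t]) s -> theta s = 1%R -> s = 1).
Proof.
have [cP hP _] := pP.1.
have [triv|ntriv] := pselect (forall g, theta g = 1%R).
  exists 1; split=> [g|s].
    by exists 1; rewrite ?triv //; apply: closed_gen_sub.
  have tr1 : is_subgroup [set (1 : P)].
    by split=> // x y /= -> ->; rewrite mulgV.
  move=> Ts _; apply: (@closed_gen_min _ _ (Subgroup tr1) _ _ _ Ts) => //=.
  by apply: compact_closed => //; exact: compact_set1.
(* The least [k1] in [D] is the first level at which some [p]-th power in the image differs from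
   [1]; below it all of them are [1], so [k = k1 - 1] is the valuation wanted. *)
pose D k := `[< exists g, (theta g ^+ p)%R k != (1%R : padic p) k >].
have exD : exists k, D k.
  move/existsNP: ntriv => [g g1]; apply: contrapT => /forallNP ND; apply: g1.
  apply: (P_tf g p (prime_gt0 p_pr)); apply: padic_inj => k.
  by apply/eqP; apply: contrapT => /negP gk; apply: (ND k); apply/asboolP; exists g.
case: (ex_minnP exD) => k1 /asboolP[t tk1] k1min.
have Dlow k g : (k < k1)%N -> (theta g ^+ p)%R k = (1%R : padic p) k.
  move=> kk1; apply/eqP; apply: contrapT => /negP gk.
  suff : (k1 <= k)%N by rewrite leqNgt kk1.
  by apply: k1min; apply/asboolP; exists g.
have k12 : (2 < k1)%N.
  rewrite ltnNge; apply/negP => k12; move/eqP: tk1; apply.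
  exact: padic_le k12 (thetaXp_res2 t).
have [k k1E] : exists k, k1 = k.+1 by exists k1.-1; rewrite prednK // (ltn_trans _ k12).
have k2 : (2 <= k)%N by rewrite -ltnS -k1E.
have [u uE] : exists u, (theta t ^+ p - 1 = (p ^ k)%N%:R * u)%R.
  by apply/padic_res_eqP => //; apply: Dlow; rewrite k1E.
have u0 : u 1%N != 0%R.
  apply/negP => /eqP /(padic_res_eq0P p_pr)[w wE]; move/eqP: tk1; apply.
  rewrite k1E; apply/padic_res_eqP => //; exists w.
  by rewrite uE wE mulrA -natrM -expnD addn1.
have tE : (theta t ^+ p = 1 + (p ^ k)%N%:R * u)%R by rewrite -uE addrC subrK.
have Tt j : subgroup_set (closed_gen [set t]) (t ^+ j).
  by apply: subgroupX; exact: closed_gen_sub.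
exists t; split=> [g|s Ts s1].
  have approx m : exists j, ((theta t ^+ p) ^+ j)%R (k + m)%N =
                            (theta g ^+ p)%R (k + m)%N.
    by rewrite tE; apply: padic_approx => //; apply: Dlow; rewrite k1E.
  have [j jE] := choice approx.
  have cT : compact (closed_gen [set t]).
    by apply: subclosed_compact cP _ => //; exact: closed_gen_closed.
  have nT : \forall m \near \oo, subgroup_set (closed_gen [set t]) (t ^+ j m).
    by exists 0%N => // m _; exact: Tt.
  (* The exponents [j m] are unrelated for different [m]; a cluster point of the powers [t ^+ j m]
     in the compact closed subgroup gives [s]. *)
  have [s [Ts cls]] := cT ((fun m => t ^+ j m) @ \oo) _ nT.
  exists s => //; apply/theta_div.
  apply: (P_tf _ p (prime_gt0 p_pr)).
  suff e : (theta s ^+ p = theta g ^+ p)%R.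
    have : theta (s ^+ p) = theta (g ^+ p) by rewrite !thetaX.
    rewrite thetaM exprMn e -exprMn -thetaM mulgV theta1 expr1n //.
  apply: padic_inj => n.
  have [|_ [[m nm <-] /= st]] := cls [set t ^+ j m | m in [set m | (n <= m)%N]] _ _
    (theta_res_open n s).
    by exists n => // m nm; exists m.
  rewrite padic_resX -st -padic_resX thetaX exprAC.
  by apply: padic_le (jE m); rewrite (leq_trans nm) // leq_addl.
apply: hausdorff_nbhs1 => // U /(pro_p_expn pP)[N [oN NU [m Nm]]].
have nN : nbhs s [set z | subgroup_set N (s^-1 * z)].
  apply/nbhs_transl; have /subgroup_openP := oN; apply: filterS => z.
  by rewrite /= mulKg.
(* A power of [t] is chosen close to [s] both modulo [N] and in its [theta] value modulo [p^(k+m)];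
   the latter will force [p^m] to divide [j], which puts [t ^+ j] in [N]. *)
have [_ [[j _ <-] [/= Nj sj]]] := closed_gen1_closure p_pr pP Ts
  (filterI nN (theta_res_open (k + m) s)).
have /dvdnP[i jE] : (p ^ m %| j)%N.
  apply: (padic_order_dvd p_pr k2 u0); rewrite -tE exprAC -thetaX.
  by rewrite padic_resX sj s1 -padic_resX expr1n.
apply: NU; have -> : s = t ^+ j * (s^-1 * t ^+ j)^-1.
  by rewrite invgM invgK mulVKg.
apply: subgroupM; last exact: subgroupV.
by rewrite jE mulnC expgnA; exact: subgroupX.
Qed.
End Theta.

(** * The quotient of Ker theta by K(P) *)

Section KummerQuotient.
Variables (p : nat) (p_pr : prime p) (P : cyclotomicPair p).
Import GRing.Theory.
Local Open Scope group_scope.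
Implicit Types g h s t : P.

Let pP : pro_p p P. Proof. exact: cyc_pro_p. Qed.

Let expn_gt1 n : (0 < n)%N -> (1 < p ^ n)%N.
Proof. by move=> n0; rewrite -(exp1n n) ltn_exp2r // prime_gt1. Qed.

Local Notation A := (quotient_group (cyc_K_ker P)).
Local Notation K := (subgroup_set (cyc_K P)).

(** Extends the projection of [Ker theta] onto [Ker theta / K(P)] by the junk
    value [1] outside [Ker theta]. *)
Definition ker_proj (g : P) : A :=
  if pselect (theta g = 1%R) is left g1 then
    coset_proj (cyc_K_ker P) (exist _ g (mem_set g1) : subgroup_type (theta_ker P))
  else 1.

Lemma ker_projE (u : subgroup_type (theta_ker P)) :
  ker_proj (val u) = coset_proj (cyc_K_ker P) u.
Proof.
rewrite /ker_proj; case: pselect => [u1|[]].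
  by congr coset_proj; apply/val_inj.
exact: (subgroup_valP u).
Qed.

Lemma ker_lift g : theta g = 1%R ->
  exists u : subgroup_type (theta_ker P), val u = g.
Proof. by move=> g1; exists (exist _ g (mem_set g1)). Qed.

Lemma ker_proj_surj (a : A) : exists2 g, theta g = 1%R & ker_proj g = a.
Proof.
have [u <-] := coset_proj_surj a; exists (val u); last exact: ker_projE.
exact: (subgroup_valP u).
Qed.

Lemma ker_projM g h : theta g = 1%R -> theta h = 1%R ->
  ker_proj (g * h) = ker_proj g * ker_proj h.
Proof.
move=> /ker_lift[u <-] /ker_lift[v <-]; rewrite !ker_projE.
by rewrite -quotient_group_mulE -ker_projE.
Qed.

Lemma ker_proj_eq g h : theta g = 1%R -> theta h = 1%R ->
  ker_proj g = ker_proj h <-> K (g^-1 * h).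
Proof.
by move=> /ker_lift[u <-] /ker_lift[v <-]; rewrite !ker_projE; exact: eq_cosetP.
Qed.

Lemma ker_proj1 : ker_proj 1 = 1.
Proof. by apply: (mulgI (ker_proj 1)); rewrite -ker_projM ?theta1 // !mulg1. Qed.

Lemma thetaV1 g : theta g = 1%R -> theta g^-1 = 1%R.
Proof. by move=> g1; have := thetaVl g; rewrite g1 mulr1. Qed.

Lemma thetaM1 g h : theta g = 1%R -> theta h = 1%R -> theta (g * h) = 1%R.
Proof. by move=> g1 h1; rewrite thetaM g1 h1 mulr1. Qed.

Lemma theta_conj g h : theta h = 1%R -> theta (g * h * g^-1) = 1%R.
Proof. by move=> h1; rewrite !thetaM h1 mulr1 mulrC thetaVl. Qed.

Lemma thetaX1 g n : theta g = 1%R -> theta (g ^+ n) = 1%R.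
Proof. by move=> g1; rewrite thetaX g1 expr1n. Qed.

(** Brings closed sets of the quotient back to [P], where limits of powers and products of compact
    sets are handled. *)
Lemma ker_proj_closed (C : set A) : closed C ->
  closed [set g | theta g = 1%R /\ C (ker_proj g)].
Proof.
move=> cC; have [D cD CD] := subgroup_closedP
  (closed_preimage (@coset_proj_continuous _ (cyc_K_ker P)) cC).
rewrite (_ : [set g | _] = (theta_ker P : set P) `&` D).
  by apply: closedI => //; exact: theta_ker_closed.
apply/seteqP; split=> g /= [g1 Cg]; split=> //; have [u uE] := ker_lift g1;
  rewrite -uE in Cg *.
- by have : (val @^-1` D) u by rewrite -CD /= -ker_projE.
- by rewrite ker_projE; have : (coset_proj (cyc_K_ker P) @^-1` C) u by rewrite CD.
Qed.

Lemma ker_proj_open (U : set A) (V : set P) : open V ->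
  (forall g, theta g = 1%R -> U (ker_proj g) <-> V g) -> open U.
Proof.
move=> oV UV; change (open (coset_proj (cyc_K_ker P) @^-1` U)).
exists V => //; apply/seteqP; split=> u; rewrite /= -ker_projE.
  by move=> Vu; apply/UV => //; exact: (subgroup_valP u).
by move=> /UV; apply; exact: (subgroup_valP u).
Qed.

Lemma padic_expg_ker h (a : padic p) : theta h = 1%R ->
  theta (padic_expg h a) = 1%R.
Proof.
move=> h1; apply: (padic_expg_closed p_pr (C := theta_ker P)) => //.
  exact: theta_ker_closed.
by exists 0%N => // n _; exact: thetaX1.
Qed.

Lemma cyc_K_gen g h : theta h = 1%R ->
  K (padic_expg h (- theta g)%R * (g * h * g^-1)).
Proof.
move=> h1; rewrite !mulgA; apply: closed_gen_sub.
by exists g => //; exists h.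
Qed.

Lemma cyc_K_min (C : set P) : closed C -> is_subgroup C ->
  (forall g h, theta h = 1%R ->
     C (padic_expg h (- theta g)%R * (g * h * g^-1))) ->
  K `<=` C.
Proof.
move=> cC sC Cgh; apply: (@closed_gen_min _ _ (Subgroup sC)) => //.
by move=> _ [g _ [h h1 <-]]; rewrite -!mulgA [g * _]mulgA; exact: Cgh.
Qed.

Lemma cyc_K_ker_sub : K `<=` theta_ker P.
Proof.
apply: cyc_K_min; [exact: theta_ker_closed | exact: subgroupP | move=> g h h1 /=].
by apply: thetaM1; [exact: padic_expg_ker | exact: theta_conj].
Qed.

Lemma kummer_quotient_pro_p : pro_p p A.
Proof.
have cval : continuous (val : subgroup_type (theta_ker P) -> P).
  exact: initial_continuous.
apply: pro_p_quotient => //; last first.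
  by apply: pro_p_subgroup => //; exact: theta_ker_closed.
exact: (closed_preimage cval (@closed_gen_closed _ _)).
Qed.

Lemma padic_expgN1 h : padic_expg h (- 1 : padic p)%R = h^-1.
Proof.
have [_ hausP _] := pP.1.
apply/esym/(mulgI h); rewrite mulgV; apply/esym.
apply: hausdorff_nbhs1 => // U /(pro_p_expn pP)[N [oN NU [k Nk]]].
apply: NU; apply: (padic_expg_closed p_pr (C := [set x | subgroup_set N (h * x)])) => //.
  by apply: (closed_preimage (@continuous_mull P h)); exact: open_subgroup_closed.
exists k => // n kn /=; rewrite -expgS.
(* The representative of [-1] modulo [p^n] is [p^n - 1], so the extra factor [h] completes the power
   to [h ^+ (p ^ n)]. *)
have -> : (`|(- 1 : padic p)%R n|.+1 = p ^ n)%N.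
  rewrite padic_resN padic_res1 modzNm.
  have pn0 : (0 < p ^ n)%N by rewrite expn_gt0 prime_gt0.
  rewrite -[(- 1)%R]/(Negz 0) modNz_nat // mod0n subr0 -[1%R]/(Posz 1) subzn //=.
  by rewrite subn1 prednK.
by rewrite -(subnKC kn) expnD expgnA; exact: subgroupX.
Qed.

(** For [g] in the kernel of [theta], the generator of [K(P)] given by [g] and [h] is the commutator
    [h^-1 g h g^-1]. *)
Lemma kummer_quotient_abelian : abelian_group A.
Proof.
move=> a b; have [g g1 <-] := ker_proj_surj a; have [h h1 <-] := ker_proj_surj b.
have := cyc_K_gen g h1; rewrite g1 padic_expgN1.
rewrite -!ker_projM //.
move=> Kgh; apply/esym/ker_proj_eq; rewrite ?thetaM1 //.
have {Kgh} := Kgh; set k := _ * _ => Kk.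
have -> : (h * g)^-1 * (g * h) = k ^ g.
  by rewrite /conjg /k invgM !mulgA !mulgVK.
exact: cyc_K_normal.
Qed.

(** Covers both the characters of [Ker theta / K(P)] and the crossed
    homomorphisms of [P]. *)
Lemma ker_padic_expg n (n_gt0 : (0 < n)%N) (f : P -> 'Z_(p ^ n)) :
  (forall v, closed [set x | theta x = 1%R /\ f x = v]) ->
  (forall g h, theta g = 1%R -> theta h = 1%R -> f (g * h) = (f g + f h)%R) ->
  forall h (a : padic p), theta h = 1%R ->
  f (padic_expg h a) = ((a n)%:~R * f h)%R.
Proof.
move=> fcl fM h a h1; have q1 := expn_gt1 n_gt0.
have f1 : f 1 = 0%R by apply: (addrI (f 1)); rewrite -fM ?theta1 // mulg1 addr0.
have fX j : f (h ^+ j) = (f h *+ j)%R.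
  elim: j => [|j IH] //.
  by rewrite expgS fM ?IH ?mulrS // thetaX1.
suff [] : [set x | theta x = 1%R /\ f x = ((a n)%:~R * f h)%R] (padic_expg h a).
  by [].
apply: padic_expg_closed => //.
exists n => // m nm; split; first exact: thetaX1.
rewrite fX -mulr_natl; congr (_ * _)%R.
transitivity ((`|a n|%N)%:R : 'Z_(p ^ n))%R.
  apply/val_inj; rewrite /= !val_Zp_nat //.
  by have := @padic_abs_mod p p_pr a n m nm.
by rewrite pmulrn gez0_abs // padic_res_ge0.
Qed.
End KummerQuotient.

(** * Crossed homomorphisms and characters of the quotient *)

Section CrossedHoms.
Variables (p : nat) (p_pr : prime p) (P : cyclotomicPair p).
Import GRing.Theory.
Local Open Scope group_scope.
Implicit Types g h s t : P.

Let pP : pro_p p P. Proof. exact: cyc_pro_p. Qed.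

Let expn_gt1 n : (0 < n)%N -> (1 < p ^ n)%N.
Proof. by move=> n0; rewrite -(exp1n n) ltn_exp2r // prime_gt1. Qed.

Local Notation A := (quotient_group (cyc_K_ker P)).
Local Notation K := (subgroup_set (cyc_K P)).
Local Notation kp := (@ker_proj p P).

Lemma intr_padicD n (n_gt0 : (0 < n)%N) (x y : padic p) :
  (((x + y) n)%:~R = (x n)%:~R + (y n)%:~R :> 'Z_(p ^ n))%R.
Proof.
rewrite -intrD; apply/eqP; rewrite -subr_eq0 -intrB Zp_int_eq0 ?expn_gt1 //.
by rewrite padic_resD -eqz_mod_dvd modz_mod.
Qed.

Lemma intr_padicM n (n_gt0 : (0 < n)%N) (x y : padic p) :
  (((x * y) n)%:~R = (x n)%:~R * (y n)%:~R :> 'Z_(p ^ n))%R.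
Proof.
rewrite -intrM; apply/eqP; rewrite -subr_eq0 -intrB Zp_int_eq0 ?expn_gt1 //.
by rewrite padic_resM -eqz_mod_dvd modz_mod.
Qed.

Lemma intr_padicN n (n_gt0 : (0 < n)%N) (x : padic p) :
  (((- x) n)%:~R = - (x n)%:~R :> 'Z_(p ^ n))%R.
Proof.
apply/eqP; rewrite -addr_eq0 -intr_padicD // addNr.
by [].
Qed.

Lemma twist_proj_fun_padic n (n_gt0 : (0 < n)%N) (x : padic p) :
  twist_proj_fun ((x n)%:~R : 'Z_(p ^ n))%R = ((x 1%N)%:~R : 'Z_(p ^ 1))%R.
Proof.
have absE m : x m = Posz `|x m| by rewrite gez0_abs // padic_res_ge0.
rewrite (absE n) (absE 1%N) -!pmulrn twist_proj_fun_nat //.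
apply/val_inj; rewrite /= !val_Zp_nat ?expn_gt1 //.
by have := @padic_abs_mod p p_pr x 1 n n_gt0.
Qed.

(** Generators [x] of [P] are corrected to [x / s x] in the kernel, with [s x] in [T]. The preimage
    [M] of the closed subgroup they generate is normal in [P], so [M T] is a closed subgroup
    containing the generators, that is [P]. As [T] meets the kernel trivially, [M] is the whole
    kernel. *)
Lemma kummer_quotient_fg (P_fg : topologically_fg P)
  (P_tf : torsion_free_pair P) : topologically_fg A.
Proof.
have [cP hausP _] := pP.1.
have [t [Ts Tinj]] := procyclic_section p_pr P_tf; set T := closed_gen _ in Ts Tinj.
have /choice[s sP] g : exists s, subgroup_set T s /\ theta s = theta g.
  by have [s Ts' sg] := Ts g; exists s.
have [S fS SP] := P_fg.
exists ((fun x => kp (x / s x)) @` S); first exact: finite_image.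
set C := closed_gen _; pose M := [set x : P | theta x = 1%R /\ subgroup_set C (kp x)].
have cM : closed M by apply: ker_proj_closed; exact: closed_gen_closed.
have MM x y : M x -> M y -> M (x * y).
  move=> [x1 Cx] [y1 Cy]; split; first exact: thetaM1.
  by rewrite ker_projM //; exact: subgroupM.
have KM x : K x -> M x.
  move=> Kx; have x1 : theta x = 1%R := cyc_K_ker_sub p_pr Kx.
  split=> //; have -> : kp x = kp 1.
    apply/esym/ker_proj_eq => //; first exact: theta1.
    by rewrite invg1 mul1g.
  by rewrite ker_proj1; exact: subgroup1.
have M1 : M 1 by apply: KM; exact: subgroup1.
have MV x : M x -> M x^-1 by exact: (closed_submonoidV p_pr pP cM M1 MM).
have MX x n : M x -> M (x ^+ n).
  move=> Mx; elim: n => [|n IH]; first exact: M1.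
  by rewrite expgS; exact: MM.
(* Modulo [K(P)], conjugation by [g] is a p-adic power, and [M] is closed under p-adic powers. *)
have MJ x g : M x -> M (g * x * g^-1).
  move=> Mx; have [x1 _] := Mx; set a := padic_expg x (- theta g)%R.
  have Ma : M a.
    apply: (padic_expg_closed p_pr (C := M)) => //.
    by exists 0%N => // n _; exact: MX.
  have := MM _ _ (MV _ Ma) (KM _ (cyc_K_gen g x1)).
  by rewrite -/a mulKg.
pose MT := [set x * y | x in M & y in (T : set P)].
have cMT : closed MT.
  apply: compact_closed => //; apply: compact_mulset;
    apply: subclosed_compact cP _ => //; exact: closed_gen_closed.
have MT_sub : is_subgroup MT.
  split; first by exists 1 => //; exists 1; rewrite ?mulg1 //; exact: subgroup1.
  move=> _ _ [x Mx [y Ty <-]] [x' Mx' [y' Ty' <-]].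
  exists (x * ((y / y') * x'^-1 * (y / y')^-1)).
    by apply: MM => //; apply: MJ; exact: MV.
  exists (y / y'); first exact: (subgroupP T).2.
  by rewrite -[LHS]mulgA mulgVK [(x' * y')^-1]invgM !mulgA.
have PMT x : MT x.
  have : subgroup_set (closed_gen S) x by rewrite SP.
  apply: (@closed_gen_min _ _ (Subgroup MT_sub)) => // y Sy.
  have [Tsy sy] := sP y; exists (y / s y).
    split; first by apply/theta_div.
    by apply: closed_gen_sub; exists y.
  by exists (s y) => //; rewrite mulgVK.
apply/seteqP; split=> // a _.
have [g g1 <-] := ker_proj_surj a.
have [x [x1 Cx] [y Ty xyg]] := PMT g.
have y1 : y = 1.
  apply: Tinj => //; have := congr1 (@theta p P) xyg.
  by rewrite thetaM x1 mul1r g1.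
by rewrite -xyg y1 mulg1.
Qed.

Section Coefficients.
Variables (n : nat) (n_gt0 : (0 < n)%N).
Local Notation M := (twist p_pr P n_gt0).

Lemma twist_actE g (m : M) : dm_act g m = ((theta g n)%:~R * (m : 'Z_(p ^ n)))%R.
Proof. by []. Qed.

Lemma twist_act1 g (m : M) : theta g = 1%R -> dm_act g m = m.
Proof.
move=> g1; rewrite -[RHS](@dm_act1 P M) !twist_actE.
by rewrite g1 theta1.
Qed.

(** [f] kills the generators of [K(P)] and turns p-adic powers into multiples, so it is equivariant
    for the twisted action. *)
Lemma character_conj (f : A -> 'Z_(p ^ n)) g h : character f ->
  theta h = 1%R -> f (kp (g * h * g^-1)) = ((theta g n)%:~R * f (kp h))%R.
Proof.
move=> cf h1; have fcl v : closed [set x | theta x = 1%R /\ f (kp x) = v].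
  apply: (@ker_proj_closed _ P [set a | f a = v]).
  by have /continuous_closedP/(_ [set v]) := cf.1; apply; exact: discrete_closed.
have fM x y : theta x = 1%R -> theta y = 1%R ->
    f (kp (x * y)) = (f (kp x) + f (kp y))%R.
  by move=> x1 y1; rewrite ker_projM // cf.2.
have e1 := padic_expg_ker p_pr (- theta g)%R h1.
have Kg := cyc_K_gen g h1.
have : f (kp (padic_expg h (- theta g)%R * (g * h * g^-1))) = 0%R.
  have -> : kp (padic_expg h (- theta g)%R * (g * h * g^-1)) = 1.
    rewrite -(@ker_proj1 p P); apply/esym/ker_proj_eq; rewrite ?theta1 //.
      by apply: thetaM1 => //; exact: theta_conj.
    by rewrite invg1 mul1g.
  exact: character1.
rewrite fM //; last exact: theta_conj.
rewrite (ker_padic_expg p_pr n_gt0 fcl fM) // => /eqP.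
rewrite intr_padicN // mulNr addrC subr_eq0 => /eqP.
by [].
Qed.

(** Each [g] decomposes as [g / s g] in the kernel times [s g] in [T]; [c] applies [f] to the kernel
    factor. The cocycle identity is [character_conj]. *)
Lemma character_extend (P_tf : torsion_free_pair P) (f : A -> 'Z_(p ^ n)) :
  character f ->
  exists2 c : P -> M, crossed_hom c & forall h, theta h = 1%R -> c h = f (kp h).
Proof.
move=> cf; have [cP hausP _] := pP.1.
have [t [Ts Tinj]] := procyclic_section p_pr P_tf; set T := closed_gen _ in Ts Tinj.
have /choice[s sP] g : exists s, subgroup_set T s /\ theta s = theta g.
  by have [s Ts' sg] := Ts g; exists s.
have s_uniq g y : subgroup_set T y -> theta y = theta g -> s g = y.
  have [Tsg sg] := sP g => Ty yg; rewrite -[LHS](mulgVK y) (Tinj (s g / y)) ?mul1g //.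
    exact: (subgroupP T).2.
  by apply/theta_div; rewrite sg yg.
have gs1 g : theta (g / s g) = 1%R.
  by apply/theta_div; have [_ ->] := sP g.
have sM g h : s (g * h) = s g * s h.
  have [[Tg sg] [Th sh]] := (sP g, sP h).
  apply: s_uniq; first exact: subgroupM.
  by rewrite !thetaM sg sh.
pose c g : M := f (kp (g / s g)).
have cT : compact (T : set P).
  by apply: subclosed_compact cP _ => //; exact: closed_gen_closed.
exists c; first split.
(* Continuity is obtained without that of [s]: each fibre of [c] is the product of a compact part of
   the kernel with [T], hence closed, and there are finitely many fibres. *)
- have fib (v : 'Z_(p ^ n)) : closed [set g | c g = v].
    rewrite (_ : [set g | c g = v] = [set x * y |
        x in [set x | theta x = 1%R /\ f (kp x) = v] & y in (T : set P)]).
      apply: compact_closed => //; apply: compact_mulset => //.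
      apply: subclosed_compact cP _ => //.
      apply: (@ker_proj_closed _ P [set a | f a = v]).
      have /continuous_closedP/(_ [set v]) := cf.1; apply; exact: discrete_closed.
    apply/seteqP; split=> [g /= cg|_ [x [x1 fx] [y Ty <-]]].
      exists (g / s g); first by [].
      by exists (s g); [have [] := sP g | rewrite mulgVK].
    by rewrite /= /c (s_uniq _ y) // ?mulgK // thetaM x1 mul1r.
  apply/locally_constantP => g.
  have : \forall h \near g, forall v : 'Z_(p ^ n), c h = v -> c g = v.
    apply: filter_forall => v; have [->|cgv] := eqVneq (c g) v.
      exact: nearW.
    have : nbhs g (~` [set h | c h = v]).
      by apply: open_nbhs_nbhs; split; [exact: closed_openC | apply/eqP].
    by apply: filterS => h chv /chv.
  by apply: filterS => h /(_ (c h) erefl).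
- move=> g h; rewrite /c sM.
  have -> : g * h / (s g * s h) = (g * (h / s h) * g^-1) * (g / s g).
    by rewrite invgM !mulgA mulgVK.
  rewrite ker_projM ?theta_conj // cf.2 character_conj // addrC.
  by rewrite twist_actE.
- move=> h h1; rewrite /c (s_uniq h 1) ?invg1 ?mulg1 ?theta1 ?h1 //.
  exact: subgroup1.
Qed.

(** On the kernel [c] is additive, and it multiplies by [theta g] under conjugation by [g]; hence it
    kills the generators of [K(P)] and factors through the quotient. *)
Lemma crossed_hom_restrict (c : P -> M) : crossed_hom c ->
  exists2 f : A -> 'Z_(p ^ n), character f &
    forall h, theta h = 1%R -> f (kp h) = c h.
Proof.
move=> [cc cM].
have cMl g h : theta g = 1%R -> c (g * h) = (c g + c h)%R.
  by move=> g1; rewrite cM twist_act1.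
have c1 : c 1 = 0%R.
  by apply: (addrI (c 1)); rewrite -cMl ?theta1 // mulg1 addr0.
have cV g : theta g = 1%R -> c g^-1 = (- c g)%R.
  by move=> g1; apply: (addrI (c g)); rewrite -cMl // mulgV c1 subrr.
have fib v : closed [set x | theta x = 1%R /\ c x = v].
  apply: (@closedI _ (theta_ker P) [set x | c x = v]).
    exact: theta_ker_closed.
  have /continuous_closedP/(_ [set v]) := cc; apply; exact: discrete_closed.
have cJ g h : theta h = 1%R ->
    c (g * h * g^-1) = ((theta g n)%:~R * (c h : 'Z_(p ^ n)))%R.
  move=> h1; rewrite -mulgA cM cMl // dm_actD addrCA addrC -cM mulgV c1 add0r.
  exact: twist_actE.
have cK x : K x -> c x = 0%R.
  suff KC : K `<=` [set x | theta x = 1%R /\ c x = 0%R] by move=> /KC[].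
  apply: cyc_K_min => //; first split.
  - by split=> //; exact: theta1.
  - move=> x' y [x1 cx] [y1 cy]; split; first exact/thetaM1/thetaV1.
    by rewrite cMl // cV // cx cy subr0.
  - move=> g h h1; have e1 := padic_expg_ker p_pr (- theta g)%R h1.
    split; first by apply: thetaM1 => //; exact: theta_conj.
    rewrite cMl // cJ // (ker_padic_expg p_pr n_gt0 fib) //; last first.
      by move=> x' y x1 _; exact: cMl.
    by rewrite -mulrDl -intr_padicD // addNr mul0r.
(* The representatives [r] are arbitrary; continuity of [c \o r] comes from that of [c] through
   [ker_proj_open]. *)
have /choice[r rP] (a : A) : exists g, theta g = 1%R /\ kp g = a.
  by have [g g1 ga] := ker_proj_surj a; exists g.
have rE h : theta h = 1%R -> c (r (kp h)) = c h.
  move=> h1; have [r1 /(ker_proj_eq r1 h1)/cK] := rP (kp h).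
  rewrite cMl ?thetaV1 // cV // addrC => /eqP.
  by rewrite subr_eq0 => /eqP.
exists (c \o r) => //; split; last first.
  move=> a b /=; have [[a1 ra] [b1 rb]] := (rP a, rP b).
  by rewrite -cMl // -(rE (r a * r b)) ?thetaM1 // ker_projM // ra rb.
apply/continuousP => U _.
apply: (@ker_proj_open _ P _ (c @^-1` U)).
  by have /continuousP := cc; apply; exact: discrete_open.
by move=> g g1; rewrite /= rE.
Qed.
End Coefficients.
End CrossedHoms.

(** * Cohomology *)

Section Lifting.
Variables (p : nat) (p_pr : prime p) (P : cyclotomicPair p).
Import GRing.Theory.
Local Open Scope group_scope.
Implicit Types g h s t : P.

Let pP : pro_p p P. Proof. exact: cyc_pro_p. Qed.

Local Notation kp := (@ker_proj p P).

Lemma twist1_act g (m : twist p_pr P (ltn0Sn 0)) : dm_act g m = m.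
Proof.
rewrite -[RHS](@dm_act1 P (twist p_pr P (ltn0Sn 0))) !twist_actE.
by rewrite !theta_res1.
Qed.

(** With [p^k] the largest power dividing all [theta g - 1], the map [W = (theta - 1) / p^k] is a
    crossed homomorphism and [W t] is a unit. A multiple [i W] matches [f] at [t] modulo [p]; both
    vanish on the kernel, hence agree modulo [p] everywhere. *)
Lemma crossed_hom_lift_section (P_tf : torsion_free_pair P) n (n_gt0 : (0 < n)%N)
    (f : P -> twist p_pr P (ltn0Sn 0)) : crossed_hom f ->
  (forall h, theta h = 1%R -> f h = 0%R) ->
  exists2 c : P -> twist p_pr P n_gt0, crossed_hom c &
    forall g, twist_proj_fun (c g : 'Z_(p ^ n)) = f g.
Proof.
move=> [fc fM0] f0.
have fM g h : f (g * h) = (f g + f h)%R by rewrite fM0 twist1_act.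
have [t [Ts _]] := procyclic_section p_pr P_tf.
have Tmin (H : subgroup P) : closed H -> subgroup_set H t ->
    closed_gen [set t] `<=` H.
  by move=> cH Ht; apply: closed_gen_min => // _ ->.
(* If [theta t = 1], then [theta] is trivial, [f] vanishes and lifts to zero. *)
have [t1|t1] := pselect (theta t = 1%R).
  have g1 g : theta g = 1%R.
    have [s Tss <-] := Ts g.
    by apply: (Tmin (theta_ker P)) Tss => //; exact: theta_ker_closed.
  exists (fun=> 0%R); first split.
  - by apply/locally_constantP => g; exact: nearW.
  - by move=> g h; rewrite twist_actE mulr0 addr0.
  - by move=> g; rewrite f0 // -(twist_proj_fun_nat p_pr 0 n_gt0).
have exk : exists k, theta t k != (1%R : padic p) k.
  apply: contrapT => /forallNP Nk; apply: t1; apply: padic_inj => k.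
  by apply/eqP; apply: contrapT => /negP /Nk.
case: (ex_minnP exk) => k1 tk1 k1min.
have [k k1E] : exists k, k1 = k.+1.
  by exists k1.-1; rewrite prednK // (padic_dvdp_neq1 tk1).
have tk : theta t k = (1%R : padic p) k.
  apply/eqP; apply: contrapT => /negP /k1min.
  by rewrite k1E ltnn.
(* The congruence [theta g = 1] modulo [p^k] holds at [t], hence on the closed subgroup it
   generates, which maps onto the image of [theta]. *)
have /choice[W WE] g : exists w, (theta g - 1 = (p ^ k)%N%:R * w)%R.
  apply/padic_res_eqP => //.
  have [s Tss <-] := Ts g.
  have Hsub : is_subgroup [set x : P | theta x k = (1%R : padic p) k].
    split; first by rewrite /= theta1.
    move=> x y /= xk yk; have : theta (x / y * y) k = (1%R : padic p) k.
      by rewrite mulgVK.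
    rewrite thetaM padic_resM yk => xyk.
    by rewrite -[theta _]mulr1 padic_resM.
  apply: (Tmin (Subgroup Hsub)) Tss => //=; exact: theta_res_closed.
have pk_inj := @padic_mulpX_inj p p_pr k.
have W0 g : theta g = 1%R -> W g = 0%R.
  by move=> g1; apply: pk_inj; rewrite /= -WE g1 subrr mulr0.
have WM g h : W (g * h) = (W g + theta g * W h)%R.
  apply: pk_inj; rewrite /= mulrDr mulrCA -!WE thetaM; ring.
have u0 : W t 1%N != 0%R.
  apply/negP => /eqP /(padic_res_eq0P p_pr)[w wE]; move/eqP: tk1; apply.
  rewrite k1E; apply/padic_res_eqP => //; exists w.
  by rewrite WE wE mulrA -natrM -expnD addn1.
have [i iE] := padic_unit_div p_pr ((f t : 'Z_(p ^ 1)) : nat)%:R%R u0.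
pose c m g : 'Z_(p ^ m) := (((i%:R * W g)%R : padic p) m)%:~R%R.
have cM m g h : (0 < m)%N -> c m (g * h) = (c m g + (theta g m)%:~R * c m h)%R.
  move=> m0; rewrite /c WM -intr_padicM // -intr_padicD //.
  by congr ((_ : padic p) m)%:~R%R; ring.
(* Division by [p^k] costs [k] digits: [theta] modulo [p^(m+k)] determines [W] modulo [p^m]. *)
have cc m : continuous (c m : P -> discrete_topology 'Z_(p ^ m)).
  apply/locally_constantP => g; have := theta_res_open (m + k) g.
  apply: filterS => h hg; rewrite /c; congr (_%:~R)%R.
  have [z zE] := (padic_res_eqP p_pr _ _ _).1 hg.
  rewrite padic_resM [in RHS]padic_resM; congr ((_ * _) %% _)%Z.
  apply/padic_res_eqP => //; exists z; apply: pk_inj.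
  rewrite /= mulrA -natrM -expnD addnC -zE mulrBr -!WE; ring.
exists (c n); first by split => [|g h]; [exact: cc | rewrite cM // twist_actE].
have cproj g : twist_proj_fun (c n g) = c 1%N g by exact: twist_proj_fun_padic.
move=> g; rewrite cproj.
have c1M : {morph (c 1%N : P -> zmodg (p ^ 1)) : x y / x * y}.
  move=> x y; rewrite cM //; congr (_ + _)%R; exact: (twist1_act x (c 1%N y)).
have [s Tss sg] := Ts g.
have c1T : c 1%N s = f s.
  apply: (@eq_on_closed_gen P (zmodg (p ^ 1)) [set t]) Tss => //.
  - exact: (@discrete_hausdorff (discrete_topology 'Z_(p ^ 1))).
  - exact: cc.
  - move=> _ ->; rewrite /c iE padic_res_nat //.
    rewrite -[RHS]natr_Zp; apply/eqP; rewrite -subr_eq0 pmulrn -intrB.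
    by rewrite Zp_int_eq0 ?expn1 ?prime_gt1 // -eqz_mod_dvd modz_mod.
have gs1 : theta (g / s) = 1%R by apply/theta_div.
have c10 : c 1%N (g / s) = 0%R by rewrite /c W0 // mulr0.
by rewrite -(mulgVK s g) c1M fM c1T (f0 _ gs1) c10.
Qed.
End Lifting.

(** * Surjectivity on H1 in terms of crossed homomorphisms *)

Section Cohomology.
Variables (p : nat) (p_pr : prime p) (P : cyclotomicPair p).
Import GRing.Theory.
Local Open Scope ring_scope.
Local Open Scope quotient_scope.

Lemma crossed_homD (G : topGroupType) (M : discreteModule G) (c d : G -> M) :
  crossed_hom c -> crossed_hom d -> crossed_hom (c + d).
Proof.
move=> /asboolP cZ /asboolP dZ; apply/asboolP.
exact: (@rpredD _ (@Z1_pred G M)).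
Qed.

Lemma crossed_homB (G : topGroupType) (M : discreteModule G) (c d : G -> M) :
  crossed_hom c -> crossed_hom d -> crossed_hom (c - d).
Proof.
move=> /asboolP cZ /asboolP dZ; apply/asboolP.
exact: (@rpredB _ (@Z1_pred G M)).
Qed.

Lemma crossed_hom_map (G : topGroupType) (M N : discreteModule G)
    (f : moduleHom M N) (c : G -> M) : crossed_hom c -> crossed_hom (f \o c).
Proof.
move=> cc; have cZ : c \in @Z1_pred G M by apply/asboolP.
by have /asboolP := Z1P (Z1_map f (MkZ1 cZ)).
Qed.

(** Since [theta] is [1] modulo [p], coboundaries with values in [Z/p(1)] vanish, so equality of
    classes there is equality of crossed homomorphisms. *)
Lemma H1_map_surjP n (n_gt0 : (0 < n)%N) :
  set_surj [set: H1 (twist p_pr P n_gt0)] [set: H1 (twist p_pr P (ltn0Sn 0))]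
    (H1_map (twist_proj p_pr P n_gt0)) <->
  forall f : P -> twist p_pr P (ltn0Sn 0), crossed_hom f ->
    exists2 c : P -> twist p_pr P n_gt0, crossed_hom c &
      forall g, twist_proj_fun (c g : 'Z_(p ^ n)) = f g.
Proof.
split=> [surj f cf|lift y _].
  have fZ : f \in Z1_pred (M := twist p_pr P (ltn0Sn 0)) by apply/asboolP.
  have [x _] := surj (\pi_(Quotient.quot (@B1 P _)) (MkZ1 fZ)) I.
  have := Z1P (repr x) => /asboolP cr.
  move=> /eqP; rewrite -Quotient.idealrBE => /asboolP[m mE].
  exists (repr x) => // g; have := mE g; rewrite twist1_act subrr.
  by move=> /eqP; rewrite -[X in X == _]/(_ - f g) subr_eq0 => /eqP.
have [c cc cE] := lift (repr y) (asboolW (Z1P (repr y))).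
have cZ : c \in Z1_pred (M := twist p_pr P n_gt0) by apply/asboolP.
exists (\pi_(Quotient.quot (@B1 P _)) (MkZ1 cZ)) => //.
rewrite H1_map_pi -[RHS]reprK; congr (\pi_(_) _).
by apply: val_inj; apply/funext => g; exact: cE.
Qed.
End Cohomology.

Theorem theorem7p1 (p : nat) (p_pr : prime p) (P : cyclotomicPair p)
    (P_fg : topologically_fg P) (P_tf : torsion_free_pair P) :
  kummerian P <->
  forall (n : nat) (n_gt0 : (0 < n)%N),
    set_surj [set: H1 (twist p_pr P n_gt0)] [set: H1 (twist p_pr P (ltn0Sn 0))]
      (H1_map (twist_proj p_pr P n_gt0)).
Proof.
split=> [freeA n n_gt0|surj].
  apply/H1_map_surjP => f cf.
  have [phi cphi phiE] := crossed_hom_restrict cf.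
  have [psi cpsi psiE] := free_abelian_lift p_pr n_gt0 freeA cphi.
  have [c [cc cM] cE] := character_extend p_pr n_gt0 P_tf cpsi.
  (* The lift [c] matches [f] on the kernel of [theta] only; the difference [f'] vanishes there and
     is lifted separately. *)
  pose f' g : twist p_pr P (ltn0Sn 0) := (f g - twist_proj_fun (c g : 'Z_(p ^ n)))%R.
  have cf' : crossed_hom f'.
    by apply: (crossed_homB cf); apply: (crossed_hom_map (twist_proj p_pr P n_gt0)).
  have [|e ce eE] := crossed_hom_lift_section P_tf n_gt0 cf'.
    by move=> h h1; rewrite /f' cE // psiE phiE // GRing.subrr.
  exists (fun g => c g + e g)%R; first exact: crossed_homD.
  move=> g; rewrite twist_proj_funD // eE /f'.
  by rewrite GRing.addrC GRing.subrK.
apply: (free_abelian_of_lifts p_pr).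
- exact: kummer_quotient_pro_p.
- exact: kummer_quotient_abelian.
- exact: kummer_quotient_fg.
move=> f n n_gt0 cf.
(* The character is extended to [P], lifted there by surjectivity, and restricted again to the
   quotient. *)
have [c cc cE] := character_extend p_pr (ltn0Sn 0) P_tf cf.
have [c' cc' c'E] := (H1_map_surjP p_pr P n_gt0).1 (surj n n_gt0) c cc.
have [g cg gE] := crossed_hom_restrict cc'.
exists g => // a; have [h h1 <-] := ker_proj_surj a.
by rewrite gE // c'E cE.
Qed.
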